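(* Every biconvex polytope arises as a cell of a tropical linear space, i.e. it is tropically isomorphic to a cell of some tropical linear space. More specifically, let $P=\mathrm{tconv}(\mathbf v_1,\dots,\mathbf v_k)\subset\mathbb R^k/\mathbb R\mathbbm 1$ be a maximal biconvex polytope, let $S$ be a finite set with a partition $S=\bigcup_{i\in[k]}S_i$ with $|S_i|\ge\max\{2,k\}$ for all $i$, and let $\Sigma^\ast=\{\mathrm{BP}_{\Gamma[G_{\mathbf w}]^\ast}:\mathbf w\in\mathrm{Vert}(P)\}$ be the associated regular matroid subdivision of $\Delta_S^{|S|-k}$, where $\Gamma[G_{\mathbf w}]^\ast$ is the dual of the gammoid $\Gamma[G_{\mathbf w}]$. Then $P$ is tropically isomorphic to the bounded part of a tropical linear space $L_{\mathbf z}\subset\mathbb R^S/\mathbb R\mathbbm 1$, $\mathbf z\in\mathrm{Dr}_{U_S^k}$, that is a polyhedral complex dual to $\Sigma^\ast$.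
   Context: Notation: $[k]=\{1,\dots,k\}$; $\mathbbm 1$ is the all-one vector; $x(A)=\sum_{s\in A}x_s$. For $a\in\mathbb R$ and vectors $\mathbf x,\mathbf y$ put $a\odot\mathbf x=a\mathbbm 1+\mathbf x$ and let $\mathbf x\boxplus\mathbf y$ be the entrywise minimum; for scalars, $a\odot b=a+b$ and $a\boxplus b=\min\{a,b\}$. A subset of $\mathbb R^k$ is tropically convex if it is closed under all tropical linear combinations $a_1\odot\mathbf x_1\boxplus\cdots\boxplus a_n\odot\mathbf x_n$; $\mathrm{tconv}(V)$ is the smallest tropically convex set containing $V$. These notions descend to $\mathbb R^k/\mathbb R\mathbbm 1$. Two tropically convex sets $X\subset\mathbb R^k/\mathbb R\mathbbm 1$ and $Y\subset\mathbb R^S/\mathbb R\mathbbm 1$ are tropically isomorphic if there is a bijection between their preimages in $\mathbb R^k$ and $\mathbb R^S$ commuting with $\boxplus$ and with $a\odot(\cdot)$ for all $a\in\mathbb R$. A biconvex polytope is an (ordinary) convex polytope in $\mathbb R^k/\mathbb R\mathbbm 1$ (for some $k\ge1$) that is the tropical convex hull of finitely many points. A full-dimensional one has a unique minimal generating set, consisting of $k$ of its vertices $\mathbf v_1,\dots,\mathbf v_k$, and at most $\binom{2k-2}{k-1}$ vertices; it is maximal if it is full-dimensional and has this maximum number of vertices. The generators are indexed so that $P=\bigcap_i\bar E_i$, where $\bar E_i=\{\mathbf x:x_j-x_j(\mathbf v_i)\le x_i-x_i(\mathbf v_i)\ \forall j\ne i\}$; the $\{i,l\}$-facet of $\bar E_i$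 is its subset where $x_l-x_l(\mathbf v_i)=x_i-x_i(\mathbf v_i)$. $\mathrm{Vert}(P)$ is the vertex set. For $\mathbf w\in\mathrm{Vert}(P)$, $G_{\mathbf w}$ is the directed graph on $[k]$ in which $(i,c)$, $c\neq i$, is an arrow if and only if $\mathbf w$ lies in the $\{i,c\}$-facet of $\bar E_i$. For a directed graph $G$ on $[k]$, let $E_j=S_j\cup\bigcup_{(j,l)\text{ arrow of }G}S_l$; $\Gamma[G]=\bigvee_{j\in[k]}U^1_{E_j}$ is the matroid union of the rank-1 uniform matroids on the $E_j$ (the rank-$k$ transversal matroid on $S$ presented by $(E_1,\dots,E_k)$). $\mathrm{BP}_M\subset\mathbb R^S$ is the convex hull of the indicator vectors of the bases of $M$; $\Delta_S^m=\mathrm{BP}_{U_S^m}$. A matroid subdivision of $\Delta_S^m$ is a finite collection of base polytopes of matroids, of the same dimension, pairwise meeting in a common (possibly empty) face, connected in codimension 1, with union $\Delta_S^m$; it is regular if it is induced by a convex function. Its cells are its members and all their faces. Dressian and tropical linear space: let $M$ be a connected matroid of rank $r$ on $S$ with set of bases $\mathcal B$. $\mathrm{Dr}_M\subset\mathbb R^{\mathcal B}/\mathbb R\mathbbm 1$ is the set of $\mathbf z=(z_B)$ such that, for every independent set $\sigma$ of size $r-1$ and every rank-$r$ set $\tau$ of size $r+1$ with $\sigma\not\subseteq\tau$, the minimum of $z_{\sigma\cup\{j\}}+z_{\tau-\{j\}}$ over $j\in\tau$ with both $\sigma\cup\{j\}$ and $\tau-\{j\}$ bases is attained at least twice. For $\mathbf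 z\in\mathrm{Dr}_M$, the tropical linear space $L_{\mathbf z}\subset\mathbb R^S/\mathbb R\mathbbm 1$ is the set of $\mathbf x$ such that for every rank-$r$ set $\tau\subseteq S$ of size $r+1$ the minimum of $z_{\tau-\{j\}}+x_j$ over $j\in\tau$ with $\tau-\{j\}\in\mathcal B$ is attained at least twice. It is a polyhedral complex: for $\mathbf x\in L_{\mathbf z}$ let $\mathcal B_{\mathbf x}$ be the set of bases $B$ minimizing $z_B-x(B)$; the cell of $L_{\mathbf z}$ having $\mathbf x$ in its relative interior is $\{\mathbf y\in\mathbb R^S/\mathbb R\mathbbm 1:\mathcal B_{\mathbf y}\supseteq\mathcal B_{\mathbf x}\}$. The bounded part is the union of the bounded cells. ''$L_{\mathbf z}$ is dual to $\Sigma^\ast$'' means: there is an inclusion-reversing bijection, taking dimension $d$ to dimension $|S|-1-d$, between the cells of $L_{\mathbf z}$ and the nonempty cells of $\Sigma^\ast$ not contained in any hyperplane $\{x_s=1\}$, $s\in S$ (equivalently, writing $\mathrm P^\ast=\mathbbm 1-\mathrm P$, the cells of $\{\mathrm P^\ast:\mathrm P\in\Sigma^\ast\}$, a subdivision of $\Delta_S^k$, not contained in any $\{x_s=0\}$). *)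

(* Defs.v *)
From mathcomp Require Export all_boot all_order all_algebra.
From mathcomp Require Export all_classical all_reals.
From mathcomp Require Export convex.

Set Implicit Arguments.
Unset Strict Implicit.
Unset Printing Implicit Defensive.

Import Order.TTheory GRing.Theory Num.Theory.

Local Open Scope classical_set_scope.
Local Open Scope ring_scope.

(* [vec R I] is the space R^I.  A subset of R^I / R1 is represented throughout
   by its preimage in R^I, i.e. by a set stable under [tscale a] for every
   [a : R]; a point of R^I / R1 is represented by any of its representatives,
   or by its class [tclass x]. *)
Notation vec R I := {ffun I -> R^o}.

Section Tropical.
Context {R : realType}.

Definition tscale {I : finType} (a : R) (x : vec R I) : vec R I :=
  [ffun i => a + x i].

Definition tmin {I : finType} (x y : vec R I) : vec R I :=
  [ffun i => Num.min (x i : R) (y i)].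

Definition tclass {I : finType} (x : vec R I) : set (vec R I) :=
  [set tscale a x | a in setT].

(* a_0 (.) x_0 [+] ... [+] a_n (.) x_n; since [tmin] is idempotent, starting
   the fold at its first term is harmless. *)
Definition tcomb {I : finType} n (a : 'I_n.+1 -> R) (x : 'I_n.+1 -> vec R I) :
    vec R I :=
  \big[@tmin I / tscale (a ord0) (x ord0)]_(i < n.+1) tscale (a i) (x i).

Definition tconvex {I : finType} (X : set (vec R I)) : Prop :=
  forall n (a : 'I_n.+1 -> R) (x : 'I_n.+1 -> vec R I),
    (forall i, X (x i)) -> X (tcomb a x).

Definition tconv {I : finType} (V : set (vec R I)) : set (vec R I) :=
  smallest tconvex V.

Definition trop_iso {I J : finType} (X : set (vec R I)) (Y : set (vec R J)) :
    Prop :=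
  [/\ tconvex X, tconvex Y &
      exists f : vec R I -> vec R J,
        [/\ set_bij X Y f,
            forall x y, X x -> X y -> f (tmin x y) = tmin (f x) (f y) &
            forall a x, X x -> f (tscale a x) = tscale a (f x)]].

End Tropical.

Section Polytopes.
Context {R : realType}.

Definition conv_hull {I : finType} (V : set (vec R I)) : set (vec R I) :=
  smallest (@convex_set R (vec R I)) V.

Definition dotp {I : finType} (c x : vec R I) : R := \sum_(i : I) c i * x i.

(* For a saturated [Q], a linear functional having a maximum on [Q] vanishes
   on the all-one vector, so these are also (the preimages of) the faces of
   Q / R1. *)
Definition face {I : finType} (F Q : set (vec R I)) : Prop :=
  F = set0 \/
  exists c : vec R I,
    F = [set x | Q x /\ forall y, Q y -> dotp c y <= dotp c x].

(* [X] is nonempty and the direction of its affine hull has dimension [d]. *)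
Definition affdim {I : finType} (X : set (vec R I)) (d : nat) : Prop :=
  X !=set0 /\
  exists U : {vspace vec R I},
    [/\ (\dim U = d)%N,
        forall x y, X x -> X y -> x - y \in U &
        forall W : {vspace vec R I},
          (forall x y, X x -> X y -> x - y \in W) -> (U <= W)%VS].

(* Dimension in R^I / R1. *)
Definition qdim {I : finType} (X : set (vec R I)) (d : nat) : Prop :=
  affdim X d.+1.

Definition qbounded {I : finType} (X : set (vec R I)) : Prop :=
  exists b : R, forall x, X x -> forall i j, `|(x i : R) - x j| <= b.

(* Nonempty convex polytopes in R^I / R1. *)
Definition qpolytope {I : finType} (P : set (vec R I)) : Prop :=
  exists V : set (vec R I),
    [/\ finite_set V, V !=set0 &
        P = [set tscale a x | a in setT & x in conv_hull V]].

Definition biconvex {I : finType} (P : set (vec R I)) : Prop :=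
  qpolytope P /\
  exists V : set (vec R I), [/\ finite_set V, V !=set0 & P = tconv V].

(* Representatives of the vertices of P in R^I / R1. *)
Definition Vert {I : finType} (P : set (vec R I)) : set (vec R I) :=
  [set w | face (tclass w) P].

Definition maximal_biconvex k (P : set (vec R 'I_k)) : Prop :=
  [/\ biconvex P, qdim P k.-1 &
      ([set tclass w | w in Vert P] #= `I_('C((2 * k - 2)%N, (k - 1)%N)))%card].

Definition min_generators k (v : 'I_k -> vec R 'I_k) (P : set (vec R 'I_k)) :
    Prop :=
  P = tconv (range v) /\
  forall i, tconv (v @` [set j | j <> i]) <> P.

(* [sector p i] is the set called E_i-bar when p = v_i. *)
Definition sector {I : finType} (p : vec R I) (i : I) : set (vec R I) :=
  [set x | forall j, j != i -> (x j : R) - p j <= (x i : R) - p i].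

Definition sector_facet {I : finType} (p : vec R I) (i l : I) :
    set (vec R I) :=
  [set x | sector p i x /\ x l - p l = x i - p i].

Definition vertex_graph {I : finType} (v : I -> vec R I) (w : vec R I) :
    rel I :=
  fun i c => (c != i) && `[< sector_facet (v i) i c w >].

End Polytopes.

(* A matroid on [S] is given by its set of bases; the notions below are
   meaningful for families satisfying [is_matroid]. *)
Section Matroids.
Context {S : finType}.
Implicit Types (M : {set {set S}}) (A B : {set S}).

Definition is_matroid M : Prop :=
  M != finset.set0 /\
  forall B1 B2, B1 \in M -> B2 \in M ->
    forall s, s \in (B1 :\: B2)%SET ->
      exists2 t, t \in (B2 :\: B1)%SET & (t |: (B1 :\ s))%SET \in M.

Definition indep M A : bool := [exists B in M, A \subset B].

Definition rank M A : nat := (\max_(B in M) #|(A :&: B)%SET|)%N.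

Definition rk M : nat := rank M [set: S]%SET.

Definition connected_matroid M : Prop :=
  forall A, A != finset.set0 -> A != [set: S]%SET ->
    (rank M A + rank M (~: A)%SET != rk M)%N.

Definition dual_matroid M : {set {set S}} := [set (~: B)%SET | B in M]%SET.

(* The uniform matroid of rank m on A, as a matroid on S in which the elements
   outside of A are loops. *)
Definition uniform (m : nat) A : {set {set S}} :=
  [set B : {set S} | (B \subset A) && (#|B| == m)]%SET.

Definition matroid_union k (M : 'I_k -> {set {set S}}) : {set {set S}} :=
  [set B : {set S} |
    maxset (fun A => [exists X : {ffun 'I_k -> {set S}},
                        [forall j, indep (M j) (X j)] &&
                        (A == \bigcup_j X j)]) B]%SET.

Definition Gamma k (Sb : 'I_k -> {set S}) (G : rel 'I_k) : {set {set S}} :=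
  matroid_union (fun j => uniform 1 (Sb j :|: \bigcup_(l | G j l) Sb l)%SET).

End Matroids.

Section Subdivisions.
Context {R : realType} {S : finType}.
Implicit Types (Sigma : set (set (vec R S))) (M : {set {set S}}).

Definition indicator (B : {set S}) : vec R S := [ffun s => (s \in B)%:R].

Definition base_polytope M : set (vec R S) :=
  conv_hull [set indicator B | B in [set` M]].

Definition hypersimplex (m : nat) : set (vec R S) :=
  base_polytope (uniform m [set: S]%SET).

Definition connected_codim1 Sigma : Prop :=
  forall X Y, Sigma X -> Sigma Y ->
    exists (n : nat) (Q : nat -> set (vec R S)),
      [/\ Q 0%N = X, Q n = Y,
          forall i, (i <= n)%N -> Sigma (Q i) &
          forall i, (i < n)%N ->
            exists d, affdim (Q i) d.+1 /\ affdim (Q i `&` Q i.+1) d].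

Definition matroid_subdivision (m : nat) Sigma : Prop :=
  [/\ finite_set Sigma,
      forall Q, Sigma Q -> exists2 M, is_matroid M & Q = base_polytope M,
      exists d, forall Q, Sigma Q -> affdim Q d,
      forall X Y, Sigma X -> Sigma Y ->
        face (X `&` Y) X /\ face (X `&` Y) Y &
      connected_codim1 Sigma /\ \bigcup_(Q in Sigma) Q = hypersimplex m].

(* The members of [Sigma] are the domains on which the convex function [f]
   coincides with one of its affine minorants. *)
Definition regular_subdivision (m : nat) Sigma : Prop :=
  exists f : vec R S -> R,
    convex_function (hypersimplex m) f /\
    forall Q, Sigma Q ->
      exists (c : vec R S) (b : R),
        forall x, hypersimplex m x ->
          dotp c x + b <= f x /\ (f x = dotp c x + b <-> Q x).

Definition subdivision_cells Sigma : set (set (vec R S)) :=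
  [set F | exists2 Q, Sigma Q & face F Q].

End Subdivisions.

Section TropicalLinearSpaces.
Context {R : realType} {S : finType}.
Implicit Types (M : {set {set S}}) (z : {set S} -> R).

(* The minimum of [f] over [J] is attained at least twice.  The minimum over
   the empty set is +oo, and the condition is then void. *)
Definition min_twice (J : {set S}) (f : S -> R) : Prop :=
  J = finset.set0 \/
  (2 <= #|[set i in J | [forall j in J, (f i <= f j)%R]]%SET|)%N.

(* The coordinates of [z] at subsets that are not bases of [M] are never used:
   [z] stands for its restriction to [M]. *)
Definition Dressian M : set ({set S} -> R) :=
  [set z | forall sigma tau : {set S},
    indep M sigma -> (#|sigma|.+1 = rk M)%N ->
    rank M tau = rk M -> (#|tau| = (rk M).+1)%N ->
    ~~ (sigma \subset tau) ->
    min_twice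
      [set j in tau | ((j |: sigma) \in M) && ((tau :\ j) \in M)]%SET
      (fun j => z (j |: sigma)%SET + z (tau :\ j)%SET)].

Definition trop_linear_space M z : set (vec R S) :=
  [set x | forall tau : {set S},
    rank M tau = rk M -> (#|tau| = (rk M).+1)%N ->
    min_twice [set j in tau | (tau :\ j) \in M]%SET
      (fun j => z (tau :\ j)%SET + x j)].

Definition min_bases M z (x : vec R S) : {set {set S}} :=
  [set B in M | [forall B' in M,
     (z B - \sum_(s in B) x s <= z B' - \sum_(s in B') x s)%R]]%SET.

Definition tls_cell M z (x : vec R S) : set (vec R S) :=
  [set y | (min_bases M z x) \subset (min_bases M z y)].

Definition tls_cells M z : set (set (vec R S)) :=
  [set tls_cell M z x | x in trop_linear_space M z].

Definition bounded_part M z : set (vec R S) :=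
  \bigcup_(C in [set C | tls_cells M z C /\ qbounded C]) C.

Definition tls_dual M z (Sigma : set (set (vec R S))) : Prop :=
  exists phi : set (vec R S) -> set (vec R S),
    [/\ set_bij (tls_cells M z)
          [set F | [/\ subdivision_cells Sigma F, F !=set0 &
                       forall s, ~ (F `<=` [set x | x s = 1])]] phi,
        forall C D, tls_cells M z C -> tls_cells M z D ->
          (C `<=` D <-> phi D `<=` phi C) &
        forall C d, tls_cells M z C -> qdim C d ->
          affdim (phi C) (#|S| - 1 - d)%N].

End TropicalLinearSpaces.

(* Main.v *)
From HB Require Import structures.
Require Import Defs.
From mathcomp Require Import interval_inference ring lra.

Set Implicit Arguments.
Unset Strict Implicit.
Unset Printing Implicit Defensive.

Import Order.TTheory GRing.Theory Num.Theory.

Local Open Scope classical_set_scope.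
Local Open Scope ring_scope.

(** The polytope [P] is an intersection of sectors with apices [v i] in [P], and
    the linear space comes from the matrix whose rows are the [v i], with the
    column [l] repeated along the block [Sb l]: [z B] is the tropical
    determinant of the columns in [B], that is, the least cost of a perfect
    matching between rows and [B].

    Let [dup x] repeat the coordinates of [x] along the blocks.  For [x] in [P],
    the cheapest columns of the row [i] at [dup x] are those of its own block
    and of the blocks on whose facets [x] lies; the blocks being large, all
    these choices are independent, and the initial matroid at [dup x] is the
    transversal matroid of the graph of [x] ([min_bases_dup]).  It has no loops
    and no coloops.  Conversely, where the initial matroid has no coloop every
    optimal matching gives each row one of its cheapest columns ([no_envy]: all
    columns have price zero), and if moreover it has no loop, the point is a
    tropical combination of the rows, hence of the form [dup x] with [x] in [P]
    ([loopless_dup]).  Since a loop or a coloop makes a cell unbounded, the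
    bounded part of the linear space is [dup P].

    The remaining claims concern the regular subdivision induced by [z]; the
    arguments apply to point configurations with a constant nonzero coordinate
    sum, on which no other linear functional is constant.  Its maximal cells
    come from the points at which the minimal family determines the point up to
    a constant ([full]).  By the simplex method, one can walk from one such point
    to another across cells of codimension one towards any target
    ([improving_path]), so the maximal cells cover the hull and are connected in
    codimension one.  A full point has neither loops nor coloops, hence is
    some [dup w], and the full points of this form are those where [w] is a
    vertex of [P] ([full_dup], [Vert_full]).

    A biconvex polytope of any dimension is cut out by sectors with apices in it
    ([biconvex_sectors]): finitely many generators that dominate a convex set
    include one that dominates it entirely.  The same linear space then has all
    of [dup P] as the cell of a point of [P] with the fewest tight constraints
    ([cell_generic]). *)

(** * Linear algebra over an ordered field *)

Section DotProduct.
Context {R : realType} {S : finType}.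
Implicit Types (c x y : vec R S) (a : R).

Lemma dotpC x y : dotp x y = dotp y x.
Proof. by apply: eq_bigr => i _; rewrite mulrC. Qed.

Lemma dotpDr c x y : dotp c (x + y) = dotp c x + dotp c y.
Proof. by rewrite -big_split; apply: eq_bigr => i _; rewrite ffunE mulrDr. Qed.

Lemma dotpZr c a x : dotp c (a *: x) = a * dotp c x.
Proof.
rewrite /dotp mulr_sumr; apply: eq_bigr => i _.
by rewrite ffunE [a *: _]/(a * _) mulrCA.
Qed.

Lemma dotpDl c x y : dotp (x + y) c = dotp x c + dotp y c.
Proof. by rewrite dotpC dotpDr !(dotpC c). Qed.

Lemma dotpZl c a x : dotp (a *: x) c = a * dotp x c.
Proof. by rewrite dotpC dotpZr dotpC. Qed.

Lemma dotpNr c x : dotp c (- x) = - dotp c x.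
Proof. by rewrite -scaleN1r dotpZr mulN1r. Qed.

Lemma dotpNl c x : dotp (- x) c = - dotp x c.
Proof. by rewrite -scaleN1r dotpZl mulN1r. Qed.

Lemma dotpBr c x y : dotp c (x - y) = dotp c x - dotp c y.
Proof. by rewrite dotpDr dotpNr. Qed.

Lemma dotpBl c x y : dotp (x - y) c = dotp x c - dotp y c.
Proof. by rewrite dotpDl dotpNl. Qed.

Lemma dotp0r c : dotp c 0 = 0.
Proof. by rewrite -(scale0r c) dotpZr mul0r. Qed.

Lemma dotp_sumr (I : finType) c (F : I -> vec R S) :
  dotp c (\sum_i F i) = \sum_i dotp c (F i).
Proof.
exact: (big_morph (dotp c) (dotpDr c) (dotp0r c)).
Qed.

Lemma dotp_eq0 x : dotp x x = 0 -> x = 0.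
Proof.
move=> /eqP; rewrite psumr_eq0 => [/allP h|i _]; last by rewrite -expr2 sqr_ge0.
apply/ffunP => i; rewrite ffunE; have := h i (mem_index_enum i).
by rewrite /= mulf_eq0 orbb => /eqP.
Qed.

Lemma dotp_gt0 x : x != 0 -> 0 < dotp x x.
Proof.
move=> x0; rewrite lt_def; apply/andP; split.
  by apply: contraNneq x0 => /dotp_eq0 ->.
by apply: sumr_ge0 => i _; rewrite -expr2 sqr_ge0.
Qed.

(** The equations of the orthogonal complement are given by a basis of [W],
    which bounds its dimension from below; positivity of the form makes it
    disjoint from [W], which bounds it from above. *)
Lemma orthogonal_complement (W : {vspace vec R S}) :
  exists2 U : {vspace vec R S},
    (forall e, e \in U <-> forall w, w \in W -> dotp e w = 0) &
    (\dim U + \dim W = #|S|)%N.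
Proof.
pose g (e : vec R S) : 'rV[R]_(\dim W) := \row_i dotp e (vbasis W)`_i.
have glin : linear g.
  by move=> a x y; apply/rowP => i; rewrite !mxE dotpDl dotpZl.
pose gL : {linear vec R S -> 'rV[R]_(\dim W)} :=
  HB.pack g (GRing.isLinear.Build _ _ _ _ g glin).
have memU e : e \in lker (linfun gL) <-> forall w, w \in W -> dotp e w = 0.
  rewrite memv_ker lfunE /=; split => [/eqP/rowP g0 w wW|h]; last first.
    apply/eqP/rowP => i; rewrite !mxE; apply/h/vbasis_mem/mem_nth.
    by rewrite size_tuple.
  rewrite (coord_vbasis wW) dotp_sumr big1 // => i _.
  by have := g0 i; rewrite !mxE dotpZr => ->; rewrite mulr0.
exists (lker (linfun gL)) => //; apply/eqP; rewrite eqn_leq; apply/andP; split.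
  rewrite -dimv_disjoint_sum; last first.
    apply/eqP; rewrite -subv0; apply/subvP => e /memv_capP[/memU eU eW].
    by rewrite (dotp_eq0 (eU e eW)) mem0v.
  by rewrite (leq_trans (dimvS (subvf _))) // dimvf /dim /= muln1.
have := limg_ker_dim (linfun gL) fullv.
rewrite capfv => dimE.
have -> : #|S| = \dim {: vec R S} by rewrite dimvf /dim /= muln1.
rewrite -dimE leq_add2l.
by rewrite (leq_trans (dimvS (subvf _))) // dimvf dim_matrix mul1r.
Qed.

End DotProduct.

Lemma small_eps {R : realType} (I : finType) (a b : I -> R) :
  (forall i, a i < 0) ->
  exists2 e : R, 0 < e & forall d, 0 < d <= e -> forall i, a i + d * b i < 0.
Proof.
move=> a0; pose f i := - a i / (`|b i| + 1).
have b1 i : 0 < `|b i| + 1 by rewrite ltr_wpDl.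
have f0 i : 0 < f i by rewrite divr_gt0 // oppr_gt0.
have [e e0 ef] : exists2 e : R, 0 < e & forall i, e <= f i.
  exists (\big[Num.min/1]_i f i) => [|i].
    by elim/big_ind: _ => // x y x0 y0; rewrite lt_min x0.
  by rewrite (bigD1 i) //= ge_min lexx.
exists e => // d /andP[d0 de] i.
have h1 : d * b i <= d * `|b i| by rewrite ler_pM2l // ler_norm.
have h2 : d * (`|b i| + 1) <= - a i.
  by rewrite -ler_pdivlMr // (le_trans de (ef i)).
have h3 : d * (`|b i| + 1) = d * `|b i| + d by rewrite mulrDr mulr1.
lra.
Qed.

(** * Convex hulls of finitely many points *)

Section ConvexCombinations.
Context {R : realType} {S : finType}.

(** Gordan's theorem: if a functional [c] is negative on all the vectors but
    [v], project them along [v] into the kernel of [c] and use induction. *)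
Lemma gordan n (w : 'I_n -> vec R S) :
  (exists l : 'I_n -> R,
     [/\ forall i, 0 <= l i, \sum_i l i = 1 & \sum_i l i *: w i = 0]) \/
  (exists c, forall i, dotp c (w i) < 0).
Proof.
elim: n w => [|n IH] w; first by right; exists 0; case.
case: (IH (fun i => w (lift ord0 i))) => [[l [l0 l1 lw]]|[c cw]].
  left; exists (fun i => if unlift ord0 i is Some j then l j else 0); split.
  - by move=> i; case: unliftP.
  - rewrite big_ord_recl unlift_none add0r -[RHS]l1.
    by apply: eq_bigr => i _; rewrite liftK.
  - rewrite big_ord_recl unlift_none scale0r add0r -[RHS]lw.
    by apply: eq_bigr => i _; rewrite liftK.
set v := w ord0; have [cv|cv] := ltP (dotp c v) 0.
  by right; exists c => i; case: (unliftP ord0 i) => [j|] -> //.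
have [v0|vN0] := eqVneq v 0.
  left; exists (fun i => (i == ord0)%:R); split.
  - by move=> i; rewrite ler0n.
  - by rewrite big_ord_recl big1 ?addr0 // => i _; rewrite eqE.
  - rewrite big_ord_recl eqxx -/v v0 scaler0 add0r big1 // => i _.
    by rewrite scale0r.
have [e e0 ce] := small_eps (fun i => dotp v (w (lift ord0 i))) cw.
(* Tilting [c] slightly towards [v] makes it positive there. *)
pose c1 := c + e *: v.
have c1v : 0 < dotp c1 v.
  rewrite dotpDl dotpZl ltr_wpDl // mulr_gt0 // dotp_gt0 //.
have c1w i : dotp c1 (w (lift ord0 i)) < 0.
  by rewrite dotpDl dotpZl; apply: ce; rewrite e0 /=.
pose t i := - dotp c1 (w (lift ord0 i)) / dotp c1 v.
have t0 i : 0 < t i by rewrite divr_gt0 // oppr_gt0.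
case: (IH (fun i => w (lift ord0 i) + t i *: v)) => [[l [l0 l1 lw]]|[c' cw']].
  have lt0 : 0 <= \sum_i l i * t i.
    by apply: sumr_ge0 => i _; rewrite mulr_ge0 // ltW.
  pose s := \sum_i l i * t i + 1; have s0 : 0 < s by rewrite ltr_wpDl.
  left; exists (fun i => (if unlift ord0 i is Some j then l j
                          else \sum_j l j * t j) / s); split.
  - by move=> i; rewrite divr_ge0 ?(ltW s0) //; case: unliftP.
  - rewrite -mulr_suml big_ord_recl unlift_none.
    under [X in _ + X]eq_bigr => i _ do rewrite liftK.
    by rewrite l1 divff // gt_eqF.
  - under eq_bigr => i _ do rewrite mulrC -scalerA.
    rewrite -scaler_sumr big_ord_recl unlift_none.
    under [X in _ + X]eq_bigr => i _ do rewrite liftK.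
    have {}lw : \sum_i l i *: w (lift ord0 i) + (\sum_i l i * t i) *: v = 0.
      rewrite scaler_suml -big_split -[RHS]lw; apply: eq_bigr => i _.
      by rewrite /= scalerDr scalerA.
    by rewrite addrC lw scaler0.
have [d d0 cd] := small_eps t cw'.
pose a := (- d - dotp c' v) / dotp c1 v.
have av : dotp (c' + a *: c1) v = - d.
  by rewrite dotpDl dotpZl /a mulfVK ?gt_eqF //; ring.
right; exists (c' + a *: c1) => i.
case: (unliftP ord0 i) => [j|] ->; last by rewrite -/v av oppr_lt0.
have tj : t j * dotp c1 v = - dotp c1 (w (lift ord0 j)).
  by rewrite /t mulfVK ?gt_eqF.
have c'j := cd d _ j; move: c'j av; rewrite d0 lexx => /(_ isT).
rewrite !dotpDl !dotpZl dotpDr dotpZr => h1 h2.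
suff -> : dotp c' (w (lift ord0 j)) + a * dotp c1 (w (lift ord0 j)) =
  dotp c' (w (lift ord0 j)) + t j * dotp c' v + d * t j by [].
have -> : dotp c1 (w (lift ord0 j)) = - (t j * dotp c1 v) by rewrite tj opprK.
have -> : d = - (dotp c' v + a * dotp c1 v) by rewrite h2 opprK.
ring.
Qed.

Context {T : finType} (p : T -> vec R S).
Implicit Types (F G : {set T}) (u x : vec R S).

Definition cvx_comb F u : Prop :=
  exists l : T -> R,
    [/\ forall t, 0 <= l t, forall t, t \notin F -> l t = 0,
        \sum_t l t = 1 & u = \sum_t l t *: p t].

Lemma cvx_comb1 F t : t \in F -> cvx_comb F (p t).
Proof.
move=> tF; exists (fun s => (s == t)%:R); split.
- by move=> s; rewrite ler0n.
- by move=> s sF; case: eqP => // st; rewrite st tF in sF.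
- by rewrite (bigD1 t) //= eqxx big1 ?addr0 // => s /negPf ->.
- rewrite (bigD1 t) //= eqxx scale1r big1 ?addr0 // => s /negPf ->.
  by rewrite scale0r.
Qed.

Lemma cvx_combS F G u : F \subset G -> cvx_comb F u -> cvx_comb G u.
Proof.
move=> /fintype.subsetP FG [l [l0 lF l1 lu]]; exists l; split=> // t tG.
by apply: lF; apply: contra tG; apply: FG.
Qed.

Lemma dotp_cvx (l : T -> R) c : dotp c (\sum_t l t *: p t) =
  \sum_t l t * dotp c (p t).
Proof. by rewrite dotp_sumr; apply: eq_bigr => t _; rewrite dotpZr. Qed.

(** This locates the support of a convex combination that maximizes a
    functional. *)
Lemma avg_le (l f : T -> R) (b : R) :
  (forall t, 0 <= l t) -> \sum_t l t = 1 -> (forall t, l t != 0 -> f t <= b) ->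
  \sum_t l t * f t <= b /\
  (\sum_t l t * f t = b -> forall t, l t != 0 -> f t = b).
Proof.
move=> l0 l1 fb.
have eqb : b = \sum_t l t * b by rewrite -mulr_suml l1 mul1r.
have le t : l t * f t <= l t * b.
  by have [->|lt] := eqVneq (l t) 0; rewrite ?mul0r // ler_wpM2l // fb.
have ge0 : forall t : T, true -> 0 <= l t * b - l t * f t.
  by move=> t _; rewrite subr_ge0.
split; first by rewrite [leRHS]eqb; apply: ler_sum.
rewrite [RHS]eqb => /eqP; rewrite eq_sym -subr_eq0 -sumrB => h t lt.
move: h; rewrite psumr_eq0 // => /allP /(_ t (mem_index_enum t)) /=.
by rewrite -mulrBr mulf_eq0 (negPf lt) subr_eq0 => /eqP.
Qed.

Lemma dotp_cvx_le F u c (b : R) : cvx_comb F u ->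
  (forall t, t \in F -> dotp c (p t) <= b) -> dotp c u <= b.
Proof.
move=> [l [l0 lF l1 ->]] le; rewrite dotp_cvx.
apply: (proj1 (avg_le l0 l1 _)) => t lt; apply: le.
by apply: contraR lt => /lF ->.
Qed.

(** Gordan's theorem for the differences with [u]. *)
Lemma cvx_sep F u : cvx_comb F u \/
  exists c, forall t, t \in F -> dotp c (p t) < dotp c u.
Proof.
case: (gordan (fun i : 'I_#|F| => p (enum_val i) - u)) => [[l [l0 l1 lw]]|[c cw]].
  left; pose L t := \sum_(i | enum_val i == t) l i.
  have LE (V : lmodType R) (f : T -> V) :
      \sum_t L t *: f t = \sum_i l i *: f (enum_val i).
    rewrite /L; under eq_bigr => t _ do rewrite scaler_suml.
    rewrite (exchange_big_dep xpredT) //=; apply: eq_bigr => i _.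
    by rewrite (big_pred1 (enum_val i)).
  exists L; split.
  - by move=> t; apply: sumr_ge0.
  - by move=> t tF; rewrite /L big1 // => i /eqP ti; rewrite -ti enum_valP in tF.
  - rewrite -l1; have := LE R^o (fun=> 1).
    under eq_bigr => t _ do rewrite [_ *: _]mulr1.
    by under [in RHS]eq_bigr => t _ do rewrite [_ *: _]mulr1.
  - rewrite LE; apply/eqP; rewrite eq_sym -subr_eq0 -[u in _ - u]scale1r -l1.
    rewrite scaler_suml -sumrB; apply/eqP; rewrite -[RHS]lw.
    by apply: eq_bigr => i _; rewrite scalerBr.
right; exists c => t tF; have := cw (enum_rank_in tF t).
by rewrite enum_rankK_in // dotpBr subr_lt0.
Qed.

Lemma convex_setP (A : set (vec R S)) :
  @convex_set R (vec R S) A <->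
  forall x y (t : R), 0 <= t <= 1 -> A x -> A y -> A (t *: x + (1 - t) *: y).
Proof.
split=> [cA x y t t01 Ax Ay|cA x y t /set_mem Ax /set_mem Ay].
  have /andP[t0 t1] := t01.
  exact: set_mem (cA x y (Itv01 t0 t1) (mem_set Ax) (mem_set Ay)).
apply/mem_set; apply: cA => //.
by apply/andP; split; [exact: ge0 | exact: le1].
Qed.

Lemma conv_hull_convex (V : set (vec R S)) : @convex_set R (vec R S) (conv_hull V).
Proof.
apply/convex_setP => x y t t01 hx hy A [cA VA].
move/convex_setP: (cA); apply => //; [exact: hx | exact: hy].
Qed.

(** The sum is divided by its total weight so that induction on the list
    applies: the head and the normalized tail are averaged. *)
Lemma convex_sum (A : set (vec R S)) (l : T -> R) (s : seq T) :
  @convex_set R (vec R S) A -> (forall t, 0 <= l t) ->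
  (forall t, l t != 0 -> A (p t)) -> 0 < \sum_(t <- s) l t ->
  A ((\sum_(t <- s) l t)^-1 *: \sum_(t <- s) l t *: p t).
Proof.
move=> /convex_setP cA l0 Ap; elim: s => [|t s IH]; first by rewrite big_nil ltxx.
rewrite !big_cons; have [->|lt] := eqVneq (l t) 0.
  by rewrite scale0r !add0r.
have ltp : 0 < l t by rewrite lt_def lt l0.
have : 0 <= \sum_(j <- s) l j by apply: sumr_ge0.
rewrite le_eqVlt => /predU1P[s0|s0] _.
  rewrite -s0 addr0 big1_seq ?addr0 => [|j /andP[_ js]].
    by rewrite scalerA mulVf // scale1r; apply: Ap.
  suff -> : l j = 0 by rewrite scale0r.
  have /esym/eqP := s0; rewrite psumr_eq0 // => /allP /(_ j js) /=.
  by move/eqP.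
set q := \sum_(j <- s) l j in s0 IH *; set X := \sum_(j <- s) _ in IH *.
have q0 : 0 < l t + q by rewrite addr_gt0.
have -> : (l t + q)^-1 *: (l t *: p t + X) =
  (l t / (l t + q)) *: p t + (1 - l t / (l t + q)) *: (q^-1 *: X).
  rewrite scalerDr !scalerA [_^-1 * l t]mulrC; congr (_ + _ *: _).
  by field; rewrite !gt_eqF.
apply: cA; last 2 first.
- exact: Ap.
- exact: IH.
by rewrite divr_ge0 ?(ltW q0) ?l0 //= ler_pdivrMr // mul1r lerDl ltW.
Qed.

Lemma conv_hullP F : conv_hull [set p t | t in [set` F]] = [set u | cvx_comb F u].
Proof.
apply/seteqP; split.
  apply: smallest_sub => [|_ [t /= tF <-]]; last exact: cvx_comb1.
  apply/convex_setP => x y t /andP[t0 t1] [l [l0 lF l1 ->]] [m [m0 mF m1 ->]].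
  exists (fun s => t * l s + (1 - t) * m s); split.
  - by move=> s; rewrite addr_ge0 // mulr_ge0 // subr_ge0.
  - by move=> s sF; rewrite lF // mF // !mulr0 addr0.
  - by rewrite big_split -!mulr_sumr l1 m1 /= !mulr1 addrC subrK.
  - rewrite !scaler_sumr -big_split; apply: eq_bigr => s _.
    by rewrite [RHS]scalerDl !scalerA.
move=> u [l [l0 lF l1 ->]].
have := @convex_sum (conv_hull [set p t | t in [set` F]]) l (index_enum T).
rewrite l1 invr1 scale1r; apply => //; first exact: conv_hull_convex.
move=> t lt; apply: sub_gen_smallest; exists t => //=.
by apply: contraR lt => /lF ->.
Qed.

End ConvexCombinations.

(** * Regular subdivisions of a point configuration *)

Section ConstantVectors.
Context {R : realType} {S : finType}.

Definition constant (e : vec R S) : Prop := forall i j, e i = e j.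

Lemma constantD e e' : constant e -> constant e' -> constant (e + e').
Proof. by move=> ce ce' i j; rewrite !ffunE (ce i j) (ce' i j). Qed.

Lemma constantZ a e : constant e -> constant (a *: e).
Proof. by move=> ce i j; rewrite !ffunE (ce i j). Qed.

Lemma constant_cst (a : R) : constant ([ffun=> a] : vec R S).
Proof. by move=> i j; rewrite !ffunE. Qed.

End ConstantVectors.

Section RegularSubdivision.
Context {R : realType} {S T : finType} (p : T -> vec R S).
Context (A : {set T}) (z : T -> R).
Implicit Types (F G : {set T}) (y d e u : vec R S).

Definition wt y t : R := z t + dotp y (p t).

Definition minfam y : {set T} :=
  [set t in A | [forall s in A, wt y t <= wt y s]]%SET.

Definition orth_to F e : Prop :=
  forall s t, s \in F -> t \in F -> dotp e (p s) = dotp e (p t).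

(** The full points are those selecting the maximal cells. *)
Definition full y : Prop := forall e, orth_to (minfam y) e -> constant e.

Lemma wtB y d (a : R) t : wt (y - a *: d) t = wt y t - a * dotp d (p t).
Proof. by rewrite /wt dotpBl dotpZl addrA. Qed.

Lemma orth_toS F G e : F \subset G -> orth_to G e -> orth_to F e.
Proof. by move=> /fintype.subsetP FG h s t sF tF; apply: h; apply: FG. Qed.

Lemma minfam_sub y : minfam y \subset A.
Proof. by apply/fintype.subsetP => t; rewrite inE => /andP[]. Qed.

Lemma minfam_orth y y' F : F \subset minfam y -> F \subset minfam y' ->
  orth_to F (y' - y).
Proof.
move=> /fintype.subsetP Fy /fintype.subsetP Fy' s t sF tF.
have eqw x : (forall r, r \in F -> r \in minfam x) -> wt x s = wt x t.
  move=> Fx; apply/eqP; rewrite eq_le.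
  have := Fx s sF; have := Fx t tF; rewrite !inE.
  by move=> /andP[tA /forall_inP ht] /andP[sA /forall_inP hs]; rewrite ht // hs.
have := eqw y Fy; have := eqw y' Fy'.
rewrite !dotpBl /wt => h1 h2; lra.
Qed.

Context (t0 : T) (t0A : t0 \in A).

Definition mu y : R := wt y [arg min_(t < t0 in A) wt y t]%O.

(** Of the affine functions with slope [- y], the largest one that is below all
    the heights. *)
Definition aff y u : R := mu y - dotp y u.

Lemma mu_le y t : t \in A -> mu y <= wt y t.
Proof. by rewrite /mu; case: arg_minP => // i iA h tA; apply: h. Qed.

Lemma minfamE y t : (t \in minfam y) = (t \in A) && (wt y t == mu y).
Proof.
rewrite inE; have [tA|//] := boolP (t \in A).
rewrite andTb; apply/forall_inP/eqP => [h|-> s]; last exact: mu_le.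
apply/eqP; rewrite eq_le mu_le // andbT /mu.
by case: arg_minP => // i iA _; apply: h.
Qed.

Lemma minfam_neq0 y : exists t, t \in minfam y.
Proof.
exists [arg min_(t < t0 in A) wt y t]%O; rewrite minfamE -/(mu y) eqxx andbT.
by case: arg_minP.
Qed.

Lemma mu_eq y (m : R) t : t \in A -> wt y t = m ->
  (forall s, s \in A -> m <= wt y s) -> mu y = m.
Proof.
move=> tA tm h; apply/eqP; rewrite eq_le -{1}tm mu_le //=.
by rewrite /mu; case: arg_minP => // i iA _; apply: h.
Qed.

Lemma aff_rep y (l : T -> R) :
  (forall t, 0 <= l t) -> (forall t, t \notin A -> l t = 0) -> \sum_t l t = 1 ->
  aff y (\sum_t l t *: p t) <= \sum_t l t * z t /\
  (aff y (\sum_t l t *: p t) = \sum_t l t * z t <->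
   forall t, t \notin minfam y -> l t = 0).
Proof.
move=> l0 lA l1.
have supA t : l t != 0 -> t \in A by apply: contraR => /lA ->.
have [] := @avg_le R T l (fun t => - wt y t) (- mu y) l0 l1.
  by move=> t /supA tA; rewrite lerN2 mu_le.
under eq_bigr => t _ do rewrite mulrN mulrDr opprD.
rewrite big_split !sumrN /= -dotp_cvx => h1 h2; rewrite /aff; split; first lra.
split=> [h t|h].
  apply: contraNeq => lt; rewrite minfamE supA //=; apply/eqP.
  by apply: oppr_inj; apply: h2 => //; lra.
have -> : \sum_t l t * z t = \sum_t l t * mu y - \sum_t l t * dotp y (p t).
  rewrite -sumrB; apply: eq_bigr => t _.
  have [tm|/h ->] := boolP (t \in minfam y); last by rewrite !mul0r subrr.
  by move: tm; rewrite minfamE => /andP[_ /eqP <-]; rewrite /wt mulrDr addrK.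
by rewrite -mulr_suml l1 mul1r dotp_cvx.
Qed.

(** On its cell, the affine function of [y] interpolates the heights; every
    other affine function lies below it, with equality on the common face. *)
Lemma cell_aff y y' u : cvx_comb p (minfam y) u ->
  aff y' u <= aff y u /\
  (aff y' u = aff y u -> cvx_comb p (minfam y :&: minfam y')%SET u).
Proof.
move=> [l [l0 lF l1 ->]].
have lA t : t \notin A -> l t = 0.
  by move=> tA; apply: lF; apply: contra tA; apply/fintype.subsetP/minfam_sub.
have [_ [_ /(_ lF) ->]] := aff_rep y l0 lA l1.
have [h1 [h2 _]] := aff_rep y' l0 lA l1; split=> // /h2 lF'.
exists l; split=> // t; rewrite inE negb_and => /orP[/lF|/lF'] //.
Qed.

Definition tight y d (b : R) : {set T} :=
  [set t in minfam y | dotp d (p t) == b]%SET.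

Lemma ray_small y d (b : R) :
  (forall t, t \in minfam y -> dotp d (p t) <= b) ->
  (exists2 t, t \in minfam y & dotp d (p t) = b) ->
  exists2 a : R, 0 < a & forall s, 0 < s <= a -> minfam (y - s *: d) = tight y d b.
Proof.
move=> db [t1 t1F t1b].
(* Only the points that are not minimal limit the step; [-1] is a dummy value. *)
pose f t := if (t \in A) && (t \notin minfam y) then mu y - wt y t else -1.
have f0 t : f t < 0.
  rewrite /f; case: ifP => [/andP[tA]|_]; last lra.
  by rewrite minfamE tA /= subr_lt0 lt_def eq_sym mu_le // andbT eq_sym.
have [a a0 fa] := small_eps (fun t => dotp d (p t) - b) f0.
exists a => // s sa; have /andP[s0 _] := sa.
have t1A : t1 \in A by apply: (fintype.subsetP (minfam_sub y)).
have ge t : t \in A -> mu y - s * b <= wt (y - s *: d) t /\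
    (wt (y - s *: d) t = mu y - s * b -> t \in tight y d b).
  move=> tA; rewrite wtB; have := fa s sa t; rewrite /f tA.
  have [tF|tF] /= := boolP (t \in minfam y).
    have /andP[_ /eqP ->] : (t \in A) && (wt y t == mu y) by rewrite -minfamE.
    move=> _; have := db t tF => h; split; first by rewrite lerD2l lerN2 ler_pM2l.
    move/addrI/oppr_inj/(mulfI (lt0r_neq0 s0)) => tb.
    by rewrite inE tF tb eqxx.
  rewrite mulrBr => h; split; first lra.
  by move=> E; exfalso; lra.
have t1w : wt (y - s *: d) t1 = mu y - s * b.
  by rewrite wtB t1b; move: t1F; rewrite minfamE => /andP[_ /eqP ->].
have muE : mu (y - s *: d) = mu y - s * b.
  by apply: mu_eq t1w _ => // t tA; case: (ge t tA).
apply/finset.setP => t; rewrite minfamE muE.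
apply/andP/idP => [[tA /eqP]|]; first by case: (ge t tA).
rewrite inE minfamE => /andP[/andP[tA /eqP tm] /eqP tb].
by rewrite tA wtB tm tb.
Qed.

(** Moving [y] against [d] keeps the tight points minimal until a point with a
    larger value of [d] becomes minimal as well. *)
Lemma ray_hit y d (b : R) :
  (forall t, t \in minfam y -> dotp d (p t) <= b) ->
  (exists2 t, t \in minfam y & dotp d (p t) = b) ->
  (exists2 t, t \in A & b < dotp d (p t)) ->
  exists (s : R) (t : T),
    [/\ 0 < s, t \in minfam (y - s *: d), b < dotp d (p t),
        mu (y - s *: d) = mu y - s * b &
        (minfam y :&: minfam (y - s *: d))%SET = tight y d b].
Proof.
move=> db [t1 t1F t1b] [t2 t2A t2b].
pose Q := [pred t | (t \in A) && (b < dotp d (p t))].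
have Qt2 : Q t2 by rewrite /= t2A.
pose f t := (wt y t - mu y) / (dotp d (p t) - b).
case: (@arg_minP _ R T t2 Q f Qt2) => t /andP[tA tb] ft.
have tF : t \notin minfam y by apply: contraL tb => /db; rewrite -leNgt.
have f0 : 0 < f t.
  rewrite divr_gt0 ?subr_gt0 //.
  by move: tF; rewrite minfamE tA /= lt_def mu_le // andbT.
exists (f t), t.
have twt : wt (y - f t *: d) t = mu y - f t * b.
  rewrite wtB; have : f t * (dotp d (p t) - b) = wt y t - mu y.
    by rewrite mulfVK // gt_eqF // subr_gt0.
  by rewrite mulrBr => h; lra.
have muE : mu (y - f t *: d) = mu y - f t * b.
  apply: (mu_eq tA twt) => s sA; rewrite wtB; have [sb|sb] := ltP b (dotp d (p s)).
    have : f t * (dotp d (p s) - b) <= wt y s - mu y.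
      by rewrite -ler_pdivlMr ?subr_gt0 //; apply: ft; rewrite /= sA.
    by rewrite mulrBr => h; lra.
  have := mu_le y sA; have : f t * dotp d (p s) <= f t * b by rewrite ler_pM2l.
  lra.
split=> //; first by rewrite minfamE tA muE twt eqxx.
apply/finset.setP => s; rewrite finset.in_setI [in LHS]minfamE.
rewrite [in LHS]minfamE [in RHS]inE minfamE.
have [sA|//] := boolP (s \in A); rewrite /= muE wtB.
case: eqP => //= ->; rewrite (inj_eq (addrI _)) (inj_eq oppr_inj).
by rewrite (inj_eq (mulfI (lt0r_neq0 f0))).
Qed.

(* The common coordinate sum makes the problem invariant under adding
   constants to [y]; the last hypothesis says that this is the only
   invariance. *)
Context (kappa : R) (kappa0 : kappa != 0).
Context (sum_p : forall t, t \in A -> \sum_s p t s = kappa).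
Context (A_gen : forall e, orth_to A e -> constant e).

Lemma dotp_cst (a : R) t : t \in A -> dotp [ffun=> a] (p t) = a * kappa.
Proof.
by move=> tA; rewrite -(sum_p tA) mulr_sumr; apply: eq_bigr => i _; rewrite ffunE.
Qed.

Lemma constant_orth e : constant e -> orth_to A e.
Proof.
move=> ce s t sA tA; have [i|noi] := pickP S; last first.
  by rewrite /dotp !big1 // => i; have := noi i.
have -> : e = [ffun=> e i] by apply/ffunP => j; rewrite ffunE.
by rewrite !dotp_cst.
Qed.

Lemma dotp_cst_cvx (a : R) u : cvx_comb p A u -> dotp [ffun=> a] u = a * kappa.
Proof.
move=> [l [l0 lA l1 ->]]; rewrite dotp_cvx -[RHS]mul1r -l1 mulr_suml.
apply: eq_bigr => t _; have [tA|/lA ->] := boolP (t \in A); last by rewrite !mul0r.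
by rewrite dotp_cst.
Qed.

Lemma minfam_constant y e : constant e -> minfam (y + e) = minfam y.
Proof.
move=> /constant_orth ce; apply/finset.setP => t; rewrite !inE.
have [tA|//] := boolP (t \in A); rewrite /=; apply: eq_forallb_in => s sA.
by rewrite /wt !dotpDl (ce s t) // !addrA lerD2r.
Qed.

(** The two points select a common family, whose orthogonal directions are
    constant. *)
Lemma full_maximal y y' : full y -> minfam y \subset minfam y' ->
  constant (y' - y) /\ minfam y' = minfam y.
Proof.
move=> fy sub; have cst := fy _ (minfam_orth (subxx _) sub).
by split=> //; rewrite -(subrK y y') addrC minfam_constant.
Qed.

(** Every point can be moved to a full one: as long as some direction is
    constant on the minimal family, follow it until a new point becomes minimal,
    with the sign that does not decrease the affine function at [u]. *)
Lemma extend_full y u : cvx_comb p A u ->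
  exists y', [/\ full y', minfam y \subset minfam y' & aff y u <= aff y' u].
Proof.
move=> uA; move: {2}(#|A| - #|minfam y|)%N (leqnn (#|A| - #|minfam y|)) => n.
elim: n y => [|n IH] y.
  rewrite leqn0 subn_eq0 => le; exists y; split=> // e oe; apply: A_gen.
  suff -> : A = minfam y by [].
  by apply/eqP; rewrite eq_sym eqEcard minfam_sub.
move=> len; have [fy|] := pselect (full y); first by exists y.
move=> /existsNP[e /not_implyP[oe ne]].
have [t1 t1F] := minfam_neq0 y.
have main e' : orth_to (minfam y) e' -> dotp e' u >= dotp e' (p t1) ->
    (exists2 t, t \in A & dotp e' (p t1) < dotp e' (p t)) ->
    exists y', [/\ full y', minfam y \subset minfam y' & aff y u <= aff y' u].
  move=> oe' eu et; set b := dotp e' (p t1) in eu et.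
  have [||s [t [s0 tF tb muE capE]]] := @ray_hit y e' b _ _ et.
  - by move=> t tF; rewrite (oe' _ _ tF t1F).
  - by exists t1.
  have sub : minfam y \subset minfam (y - s *: e').
    apply/finset.setIidPl; rewrite capE; apply/finset.setP => r; rewrite inE.
    by case: (boolP (r \in minfam y)) => // rF; rewrite (oe' _ _ rF t1F) eqxx.
  pose y1 := y - s *: e'.
  have [|y' [fy' sub' le']] := IH y1.
    have : (#|minfam y| < #|minfam y1|)%N.
      apply: proper_card; rewrite properE sub; apply/negP => /fintype.subsetP.
      by move=> /(_ _ tF) /oe' /(_ t1F) E; rewrite /b E ltxx in tb.
    move=> lt; have := subset_leq_card (minfam_sub y1).
    by move=> h; rewrite -ltnS (leq_trans _ len) // ltn_sub2l // (leq_trans lt).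
  exists y'; split=> //; first exact: fintype.subset_trans sub'.
  apply: le_trans le'; rewrite /aff muE dotpBl dotpZl.
  by have : s * b <= s * dotp e' u; [rewrite ler_pM2l | lra].
have noe : orth_to (minfam y) (- e) by move=> s t sF tF; rewrite !dotpNl (oe s t).
have [t tA tN] : exists2 t, t \in A & dotp e (p t) != dotp e (p t1).
  apply: contrapT => h; apply: ne; apply: A_gen => s t sA tA.
  have eqt r : r \in A -> dotp e (p r) = dotp e (p t1).
    by move=> rA; apply/eqP; apply: contrapT => /negP hr; apply: h; exists r.
  by rewrite !eqt.
have exgt e' : dotp e' (p t1) < dotp e' u ->
    exists2 t, t \in A & dotp e' (p t1) < dotp e' (p t).
  move=> lt; apply: contrapT => h; move: lt; apply/negP; rewrite -leNgt.
  apply: (dotp_cvx_le uA) => r rA; rewrite leNgt; apply/negP => hr.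
  by apply: h; exists r.
case: (ltgtP (dotp e (p t1)) (dotp e u)) => [lt|gt|eq].
- by apply: (main e) => //; [exact: ltW | exact: exgt].
- apply: (main (- e)) => //; first by rewrite !dotpNl lerN2 ltW.
  by apply: exgt; rewrite !dotpNl ltrN2.
- case: (ltgtP (dotp e (p t1)) (dotp e (p t))) => [lt|gt|E].
  + by apply: (main e) => //; [rewrite eq | exists t].
  + apply: (main (- e)) => //; first by rewrite !dotpNl eq.
    by exists t; rewrite // !dotpNl ltrN2.
  + by rewrite E eqxx in tN.
Qed.

(** The improving directions at [y] form a cone, pointed up to constants.  One
    with the largest tight set spans an extreme ray: otherwise another direction,
    orthogonal to the tight points and to [u], could be added until a new point
    is tight. *)
Lemma extreme_ray y u c : cvx_comb p A u -> full y ->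
  (forall t, t \in minfam y -> dotp c (p t) <= 0) ->
  (exists2 t, t \in minfam y & dotp c (p t) = 0) -> 0 < dotp c u ->
  exists d, [/\ forall t, t \in minfam y -> dotp d (p t) <= 0,
    exists2 t, t \in minfam y & dotp d (p t) = 0, 0 < dotp d u &
    forall e, orth_to (tight y d 0) e -> exists a : R, constant (e - a *: d)].
Proof.
move=> uA fy.
move: {2}(#|minfam y| - #|tight y c 0%R|)%N
  (leqnn (#|minfam y| - #|tight y c 0%R|)) => n.
elim: n c => [|n IH] c len c0 ct cu.
  exists c; split=> // e oe; exists 0; rewrite scale0r subr0; apply: fy.
  suff <- : tight y c 0 = minfam y by [].
  apply/eqP; rewrite eqEcard -subn_eq0 -leqn0 len andbT.
  by apply/fintype.subsetP => t; rewrite inE => /andP[].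
have [h|] := pselect (forall e, orth_to (tight y c 0) e ->
  exists a : R, constant (e - a *: c)); first by exists c; split.
move=> /existsNP[e /not_implyP[oe ne]].
have [t1 t1F t1c] := ct.
have t1A : t1 \in A by apply: (fintype.subsetP (minfam_sub y)).
have t1T : t1 \in tight y c 0 by rewrite inE t1F t1c eqxx.
pose e1 := e - [ffun=> dotp e (p t1) / kappa].
pose e2 := e1 - (dotp e1 u / dotp c u) *: c.
have e1T t : t \in tight y c 0 -> dotp e1 (p t) = 0.
  move=> tT; rewrite dotpBl (oe t t1 tT t1T) dotp_cst ?mulfVK ?subrr //.
  by apply: (fintype.subsetP (minfam_sub y)); move: tT; rewrite inE => /andP[].
have e2T t : t \in tight y c 0 -> dotp e2 (p t) = 0.
  move=> tT; rewrite dotpBl e1T // dotpZl.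
  by move: tT; rewrite inE => /andP[_ /eqP ->]; rewrite mulr0 subrr.
have e2u : dotp e2 u = 0.
  by rewrite dotpBl dotpZl mulfVK ?subrr // gt_eqF.
have e2N : ~ constant e2.
  move=> ce2; apply: ne; exists (dotp e1 u / dotp c u).
  have -> : e - (dotp e1 u / dotp c u) *: c =
    e2 + [ffun=> dotp e (p t1) / kappa] by rewrite /e2 /e1 addrAC subrK.
  by apply: constantD => //; apply: constant_cst.
have [t tF tN] : exists2 t, t \in minfam y & dotp e2 (p t) != 0.
  apply: contrapT => h; apply: e2N; apply: fy => s t sF tF.
  have eqt r : r \in minfam y -> dotp e2 (p r) = 0.
    by move=> rA; apply/eqP; apply: contrapT => /negP hr; apply: h; exists r.
  by rewrite !eqt.
have [e3 [e3u e3T e3t]] : exists e3, [/\ dotp e3 u = 0,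
    forall t, t \in tight y c 0 -> dotp e3 (p t) = 0 & 0 < dotp e3 (p t)].
  case: (ltgtP 0 (dotp e2 (p t))) => [lt|gt|E].
  - by exists e2.
  - exists (- e2); split; first by rewrite dotpNl e2u oppr0.
      by move=> s sT; rewrite dotpNl e2T // oppr0.
    by rewrite dotpNl oppr_gt0.
  - by rewrite -E eqxx in tN.
pose Q := [pred t | (t \in minfam y) && (0 < dotp e3 (p t))].
have Qt : Q t by rewrite /= tF.
pose f t := - dotp c (p t) / dotp e3 (p t).
case: (@arg_minP _ R T t Q f Qt) => r /andP[rF r0] fr.
have cneg s : s \in minfam y -> 0 < dotp e3 (p s) -> dotp c (p s) < 0.
  move=> sF s0; rewrite lt_def c0 // andbT eq_sym.
  by apply: contraL s0 => /eqP s0; rewrite e3T ?ltxx // inE sF s0 eqxx.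
have f0 : 0 < f r by rewrite divr_gt0 // oppr_gt0 cneg.
have c'0 s : s \in minfam y -> dotp (c + f r *: e3) (p s) <= 0.
  move=> sF; rewrite dotpDl dotpZl; have [s0|s0] := ltP 0 (dotp e3 (p s)).
    have : f r * dotp e3 (p s) <= - dotp c (p s).
      by rewrite -ler_pdivlMr //; apply: fr; rewrite /= sF.
    by move=> h; lra.
  have := c0 s sF; have : f r * dotp e3 (p s) <= 0 by rewrite pmulr_rle0.
  by move=> h1 h2; lra.
have rz : dotp (c + f r *: e3) (p r) = 0.
  by rewrite dotpDl dotpZl mulfVK ?subrr // gt_eqF.
pose c1 := c + f r *: e3.
apply: (IH c1) => //.
- suff : (#|tight y c 0%R| < #|tight y c1 0%R|)%N.
    move=> lt; have : (#|tight y c1 0%R| <= #|minfam y|)%N.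
      by apply: subset_leq_card; apply/fintype.subsetP => s; rewrite inE => /andP[].
    by move=> h; rewrite -ltnS (leq_trans _ len) // ltn_sub2l // (leq_trans lt).
  apply: proper_card; rewrite properE; apply/andP; split.
    apply/fintype.subsetP => s sT; rewrite inE dotpDl dotpZl e3T // mulr0 addr0.
    by move: sT; rewrite inE.
  apply/negP => /fintype.subsetP /(_ r).
  by rewrite inE rF rz eqxx => /(_ isT) /e3T r3; rewrite r3 ltxx in r0.
- by exists r.
- by rewrite dotpDl dotpZl e3u mulr0 addr0.
Qed.

(** The points common to both families have, up to constants, a single
    orthogonal direction, so that the two cells meet in codimension one. *)
Definition edge y y' : Prop :=
  exists d, [/\ exists t, t \in (minfam y :&: minfam y')%SET,
    ~ constant d, orth_to (minfam y :&: minfam y')%SET d &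
    forall e, orth_to (minfam y :&: minfam y')%SET e ->
      exists a : R, constant (e - a *: d)].

(** The simplex method: a point outside of the cell of [y] is separated from
    it, and the extreme rays improve the affine function at that point. *)
Lemma improving_edge y u : cvx_comb p A u -> full y ->
  ~ cvx_comb p (minfam y) u ->
  exists y', [/\ full y', aff y u < aff y' u & edge y y'].
Proof.
move=> uA fy uN; case: (cvx_sep p (minfam y) u) => // -[c cu].
have [t1 t1F t1max] : exists2 t, t \in minfam y &
    forall s, s \in minfam y -> dotp c (p s) <= dotp c (p t).
  have [t tF] := minfam_neq0 y.
  by case: (@arg_maxP _ R T t (mem (minfam y)) (fun s => dotp c (p s)) tF) => r; exists r.
have t1A : t1 \in A by apply: (fintype.subsetP (minfam_sub y)).
pose b := dotp c (p t1).
(* Subtracting a constant vector brings the maximum over the cell to zero. *)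
pose c' := c - [ffun=> b / kappa].
have c'E t : t \in A -> dotp c' (p t) = dotp c (p t) - b.
  by move=> tA; rewrite dotpBl dotp_cst // mulfVK.
have inA := fintype.subsetP (minfam_sub y).
have [|||d [d0 dt du dray]] := @extreme_ray y u c' uA fy.
- by move=> t tF; rewrite c'E ?inA // subr_le0 t1max.
- by exists t1; rewrite // c'E // subrr.
- by rewrite dotpBl dotp_cst_cvx // mulfVK // subr_gt0 cu.
have dA : exists2 t, t \in A & 0 < dotp d (p t).
  apply: contrapT => h; move: du; apply/negP; rewrite -leNgt.
  apply: (dotp_cvx_le uA) => r rA; rewrite leNgt; apply/negP => hr.
  by apply: h; exists r.
have [s [t [s0 tF tb muE capE]]] := ray_hit d0 dt dA.
have tightsub : tight y d 0 \subset minfam (y - s *: d).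
  by rewrite -capE finset.subsetIr.
have [t2 t2F t2d] := dt.
have t2T : t2 \in tight y d 0 by rewrite inE t2F t2d eqxx.
exists (y - s *: d); split.
- move=> e oe; have [a ca] := dray e (orth_toS tightsub oe).
  suff a0 : a = 0 by move: ca; rewrite a0 scale0r subr0.
  have := constant_orth ca.
  move=> /(_ t t2); rewrite !dotpBl !dotpZl t2d mulr0 subr0.
  have tA : t \in A by apply: (fintype.subsetP (minfam_sub (y - s *: d))).
  have t2A : t2 \in A by apply: inA.
  rewrite (oe t t2 tF (fintype.subsetP tightsub _ t2T)) => /(_ tA t2A) E.
  have /eqP : a * dotp d (p t) = 0 by lra.
  by rewrite mulf_eq0 (gt_eqF tb) orbF => /eqP.
- by rewrite /aff muE dotpBl dotpZl; have : 0 < s * dotp d u; [rewrite mulr_gt0 | lra].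
- exists d; rewrite capE; split=> //; first by exists t2.
    move=> /constant_orth cd; have tA : t \in A.
      by apply: (fintype.subsetP (minfam_sub (y - s *: d))).
    by have := cd t t2 tA (inA _ t2F); rewrite t2d => E; rewrite E ltxx in tb.
  by move=> r r'; rewrite !inE => /andP[_ /eqP ->] /andP[_ /eqP ->].
Qed.

(** The measure that decreases along improving paths; it counts minimal families
    instead of points in order to be finite. *)
Definition better y u : {set {set T}} :=
  [set F | `[< exists y', [/\ full y', minfam y' = F & aff y u < aff y' u] >]]%SET.

(** Each improving edge leaves fewer better full points, so the walk stops, and
    it can only stop in a cell that contains [u]. *)
Lemma improving_path y u : cvx_comb p A u -> full y ->
  exists (n : nat) (q : nat -> vec R S),
    [/\ q 0%N = y, forall i, full (q i), forall i, (i < n)%N -> edge (q i) (q i.+1) &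
        cvx_comb p (minfam (q n)) u].
Proof.
move=> uA; move: {2}#|better y u| (leqnn #|better y u|) => m.
elim: m y => [|m IH] y le fy.
  exists 0%N, (fun=> y); split=> //; apply: contrapT => /(improving_edge uA fy).
  move=> [y' [fy' lt _]]; move: le; rewrite leqn0 cards_eq0 => /eqP b0.
  suff : minfam y' \in better y u by rewrite b0 inE.
  by rewrite inE; apply/asboolP; exists y'.
have [uy|] := pselect (cvx_comb p (minfam y) u); first by exists 0%N, (fun=> y).
move=> /(improving_edge uA fy) [y' [fy' lt ed]].
have [||n [q [q0 fq eq uq]]] := IH y'; last 1 first.
- exists n.+1, (fun i => if i is j.+1 then q j else y); split=> //.
  + by case.
  + by case=> [_|i]; [rewrite q0 | exact: eq].
- rewrite -ltnS (leq_trans _ le) //; apply: proper_card; rewrite properE.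
  apply/andP; split.
    apply/fintype.subsetP => F; rewrite !finset.in_set => /asboolP[y2 [f2 m2 l2]].
    by apply/asboolP; exists y2; split=> //; apply: lt_trans l2.
  apply/negP => /fintype.subsetP /(_ (minfam y')).
  rewrite !finset.in_set => /(_ _)/asboolP[|y2 [f2 m2 l2]].
    by apply/asboolP; exists y'.
  have [] := full_maximal f2 (y' := y').
    by rewrite m2 subxx.
  move=> cst _; suff : aff y2 u = aff y' u by move=> E; rewrite E ltxx in l2.
  have [t tF] := minfam_neq0 y'.
  move: (tF); rewrite -m2 minfamE => /andP[tA /eqP E2].
  move: (tF); rewrite minfamE => /andP[_ /eqP E1]; rewrite /aff -E1 -E2.
  have [i _|noi] := pickP S; last first.
    by rewrite /wt /dotp !big1 // => i; have := noi i.
  have yE : y' = y2 + [ffun=> (y' - y2) i].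
    apply/ffunP => j; rewrite ffunE [X in _ + X]ffunE -(cst j i) !ffunE.
    by rewrite addrC subrK.
  rewrite yE; set a := (y' - y2) i; rewrite /wt !dotpDl dotp_cst // dotp_cst_cvx //.
  by ring.
- exact: fy'.
Qed.

Lemma covering u : cvx_comb p A u ->
  exists2 y, full y & cvx_comb p (minfam y) u.
Proof.
move=> uA; have [y [fy _ _]] := extend_full 0 uA.
by have [n [q [_ fq _ uq]]] := improving_path uA fy; exists (q n).
Qed.

Lemma barycenter F : (exists t, t \in F) ->
  exists l : T -> R, [/\ forall t, 0 <= l t, forall t, (l t == 0) = (t \notin F) &
    \sum_t l t = 1].
Proof.
move=> [t tF]; exists (fun s => if s \in F then (#|F|%:R)^-1 else 0).
have F0 : #|F|%:R != 0 :> R by rewrite pnatr_eq0 -lt0n; apply/card_gt0P; exists t.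
split=> [s|s|]; first by case: ifP => // _; rewrite invr_ge0.
  by case: ifP => // _; rewrite ?eqxx // invr_eq0 (negPf F0).
by rewrite -big_mkcond sumr_const -[_ *+ _]mulr_natr mulVf.
Qed.

(** Walk towards the barycenter of the cell of [y'], which lies in no other
    maximal cell. *)
Lemma full_connected y y' : full y -> full y' ->
  exists (n : nat) (q : nat -> vec R S),
    [/\ q 0%N = y, forall i, full (q i),
        forall i, (i < n)%N -> edge (q i) (q i.+1) &
        minfam (q n) = minfam y'].
Proof.
move=> fy fy'; have [l [l0 lF l1]] := barycenter (minfam_neq0 y').
pose u := \sum_t l t *: p t.
have lF' t : t \notin minfam y' -> l t = 0 by rewrite -lF => /eqP.
have uy' : cvx_comb p (minfam y') u by exists l.
have uA := cvx_combS (minfam_sub y') uy'.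
have [n [q [q0 fq eq uq]]] := improving_path uA fy.
exists n, q; split=> //; apply: (proj2 (full_maximal fy' _)).
have lA t : t \notin A -> l t = 0.
  by move=> tA; apply: lF'; apply: contra tA; apply/fintype.subsetP/minfam_sub.
have [_ [_ /(_ lF') y'E]] := aff_rep y' l0 lA l1.
have [le [sup _]] := aff_rep (q n) l0 lA l1.
apply/fintype.subsetP => t; apply: contraLR => tq; rewrite -lF; apply/eqP.
apply: sup => //; apply/eqP; rewrite eq_le le -y'E.
exact: (proj1 (cell_aff y' uq)).
Qed.

(** The function is the lower convex envelope of the heights; its value at [u]
    is given by the affine function of any cell that contains [u]. *)
Lemma regular_height : exists f : vec R S -> R,
  (forall u v (a : R), 0 <= a <= 1 -> cvx_comb p A u -> cvx_comb p A v ->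
     f (a *: u + (1 - a) *: v) <= a * f u + (1 - a) * f v) /\
  forall y u, cvx_comb p A u ->
    aff y u <= f u /\ (f u = aff y u <-> cvx_comb p (minfam y) u).
Proof.
have /choice[g gP] : forall u, exists y,
    cvx_comb p A u -> full y /\ cvx_comb p (minfam y) u.
  move=> u; have [/covering[y fy uy]|uN] := pselect (cvx_comb p A u).
    by exists y.
  by exists 0.
have le y u : cvx_comb p A u -> aff y u <= aff (g u) u.
  by move=> /gP[_ ug]; apply: (proj1 (cell_aff y ug)).
exists (fun u => aff (g u) u); split.
  move=> u v a /andP[a0 a1] uA vA; set w := _ + _; set y := g w.
  have -> : aff y w = a * aff y u + (1 - a) * aff y v.
    rewrite /aff /w dotpDr !dotpZr; ring.
  by rewrite lerD // ler_wpM2l ?subr_ge0 // le.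
move=> y u uA; split; first exact: le.
have [_ ug] := gP _ uA; split=> [E|uy].
  have [_ /(_ (esym E))] := cell_aff y ug.
  by apply: cvx_combS; apply: finset.subsetIr.
apply/eqP; rewrite eq_le le // andbT.
exact: (proj1 (cell_aff (g u) uy)).
Qed.

Lemma cell_cap y y' u : cvx_comb p (minfam y) u -> cvx_comb p (minfam y') u ->
  cvx_comb p (minfam y :&: minfam y')%SET u.
Proof.
move=> uy uy'; apply: (proj2 (cell_aff y' uy)).
by apply/eqP; rewrite eq_le (proj1 (cell_aff y' uy)) (proj1 (cell_aff y uy')).
Qed.

End RegularSubdivision.

(** * Dimensions and faces of cells *)

Section Dimension.
Context {R : realType} {S T : finType} (p : T -> vec R S).
Implicit Types (F : {set T}) (e y : vec R S).

Lemma affdim_uniq (X : set (vec R S)) m n : affdim X m -> affdim X n -> m = n.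
Proof.
move=> [_ [U [<- UX Umin]]] [_ [W [<- WX Wmin]]].
by apply/eqP; rewrite eqn_leq !dimvS // ?Umin ?Wmin.
Qed.

(** The directions of the hull are spanned by the differences of the points, of
    which [orth_to] describes the orthogonal complement. *)
Lemma orth_dim F : (exists t, t \in F) ->
  exists U : {vspace vec R S},
    [/\ forall e, e \in U <-> orth_to p F e, (\dim U <= #|S|)%N &
        affdim [set u | cvx_comb p F u] (#|S| - \dim U)].
Proof.
move=> [t0 t0F].
pose W := <<[seq p s - p t | s <- enum F, t <- enum F]>>%VS.
have memW s t : s \in F -> t \in F -> p s - p t \in W.
  by move=> sF tF; apply/memv_span/allpairs_f; rewrite mem_enum.
have subW (V : {vspace vec R S}) :
    (forall s t, s \in F -> t \in F -> p s - p t \in V) -> (W <= V)%VS.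
  move=> h; apply/span_subvP => _ /allpairsP[[s t] /= [sF tF ->]].
  by apply: h; rewrite -mem_enum.
have [U memU dimU] := orthogonal_complement W.
exists U; split; last 1 first.
- split; first by exists (p t0); apply: cvx_comb1.
  exists W; split; first by rewrite -dimU addKn.
    move=> x y [l [l0 lF l1 ->]] [m [m0 mF m1 ->]].
    have half (r : T -> R) : (forall t, t \notin F -> r t = 0) -> \sum_t r t = 1 ->
        \sum_t r t *: p t - p t0 \in W.
      move=> rF r1; rewrite -[p t0 in X in X \in _]scale1r -r1 scaler_suml -sumrB.
      apply: memv_suml => t _; rewrite -scalerBr.
      have [tF|/rF ->] := boolP (t \in F); last by rewrite scale0r mem0v.
      by rewrite memvZ // memW.
    have -> : \sum_t l t *: p t - \sum_t m t *: p t =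
      (\sum_t l t *: p t - p t0) - (\sum_t m t *: p t - p t0).
      by rewrite opprB addrA subrK.
    by rewrite rpredB // half.
  move=> V hV; apply: subW => s t sF tF.
  by apply: hV; apply: cvx_comb1.
- move=> e; rewrite memU; split=> [h s t sF tF|h w].
    by apply/eqP; rewrite -subr_eq0 -dotpBr h // memW.
  have [V memV _] := orthogonal_complement <[e]>%VS.
  have sub : (W <= V)%VS.
    apply: subW => s t sF tF; apply/memV => _ /vlineP[a ->].
    by rewrite dotpZr dotpC dotpBr (h s t) // subrr mulr0.
  move=> wW; have /memV := subvP sub w wW.
  by rewrite dotpC; apply; apply: memv_line.
- by rewrite -dimU leq_addr.
Qed.

(** A small move along a direction orthogonal to the minimal family stays in the
    dual cell. *)
Lemma dual_cell_dim (A : {set T}) (z : T -> R) (t0 : T) y (U : {vspace vec R S}) :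
  t0 \in A -> (forall e, e \in U <-> orth_to p (minfam p A z y) e) ->
  affdim [set y' | minfam p A z y \subset minfam p A z y'] (\dim U).
Proof.
move=> t0A memU; split; first by exists y => /=.
exists U; split=> // [x x' xC x'C|W hW].
  by apply/memU; apply: minfam_orth x'C xC.
apply/subvP => e /memU oe; have [t tF] := minfam_neq0 p z t0A y.
have tightE : tight p A z y e (dotp e (p t)) = minfam p A z y.
  apply/finset.setP => s; rewrite finset.in_set.
  by have [sF|//] := boolP (s \in minfam p A z y); rewrite (oe s t) // eqxx.
have [||a a0 ha] := @ray_small R S T p A z t0 t0A y e (dotp e (p t)).
- by move=> s sF; rewrite (oe s t).
- by exists t.
have /hW : minfam p A z y \subset minfam p A z (y - a *: e).
  by rewrite ha ?a0 //= tightE.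
move=> /(_ y (subxx _)); rewrite addrAC subrr add0r rpredN => aeW.
by rewrite -[e]scale1r -(mulVf (lt0r_neq0 a0)) -scalerA memvZ.
Qed.

Lemma argmax_cvx F c (b : R) :
  (forall t, t \in F -> dotp c (p t) <= b) ->
  (exists2 t, t \in F & dotp c (p t) = b) ->
  [set u | cvx_comb p F u /\ forall v, cvx_comb p F v -> dotp c v <= dotp c u] =
  [set u | cvx_comb p [set t in F | dotp c (p t) == b]%SET u].
Proof.
move=> cb [t tF tb]; apply/seteqP; split=> u /=.
  move=> [[l [l0 lF l1 ->]] umax]; exists l; split=> // s.
  rewrite finset.in_set negb_and => /orP[/lF //|sb].
  have [_ h] := @avg_le R T l (fun t => dotp c (p t)) b l0 l1
    (fun r lr => cb r (contraR (fun rF => introT eqP (lF r rF)) lr)).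
  apply: contraNeq sb => ls; apply/eqP; apply: h => //.
  apply/eqP; rewrite eq_le -!dotp_cvx -{2}tb umax ?andbT; last exact: cvx_comb1.
  apply: (@dotp_cvx_le _ _ _ p F) => //; first by exists l.
move=> [l [l0 lF l1 ->]]; split.
  exists l; split=> // s sF; apply: lF; rewrite finset.in_set negb_and sF //.
move=> v vF; apply: le_trans (dotp_cvx_le vF cb) _; rewrite dotp_cvx.
rewrite (eq_bigr (fun t => l t * b)) -?mulr_suml ?l1 ?mul1r // => s _.
have [->|ls] := eqVneq (l s) 0; first by rewrite !mul0r.
have : s \in [set t in F | dotp c (p t) == b]%SET.
  by apply: contraR ls => /lF ->.
by rewrite finset.in_set => /andP[_ /eqP ->].
Qed.

End Dimension.

Section CellGeometry.
Context {R : realType} {S T : finType} (p : T -> vec R S).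
Context (A : {set T}) (z : T -> R) (t0 : T) (t0A : t0 \in A).
Implicit Types (y : vec R S).

Let cell y : set (vec R S) := [set u | cvx_comb p (minfam p A z y) u].

(** On the cell of [y] the affine function of [y'] is below that of [y], and the
    common part is where the two agree. *)
Lemma cap_face y y' : face (cell y `&` cell y') (cell y).
Proof.
have [[u0 [uy uy']]|N] := pselect (exists u, (cell y `&` cell y') u); last first.
  by left; apply/seteqP; split=> // u hu; exfalso; apply: N; exists u.
have le v : cell y v -> aff p A z t0 y' v <= aff p A z t0 y v.
  by move=> vy; apply: (proj1 (cell_aff t0A _ vy)).
have eq0 : aff p A z t0 y' u0 = aff p A z t0 y u0.
  apply/eqP; rewrite eq_le le //=.
  exact: (proj1 (cell_aff t0A _ uy')).
right; exists (y - y'); apply/seteqP; split=> u /=.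
  move=> [cu cu']; split=> // v cv; rewrite !dotpBl.
  have eqv : aff p A z t0 y' u = aff p A z t0 y u.
    by apply/eqP; rewrite eq_le le //=; apply: (proj1 (cell_aff t0A _ cu')).
  have := le v cv; move: eqv; rewrite /aff => h1 h2; lra.
move=> [cu umax]; split=> //.
have : aff p A z t0 y' u = aff p A z t0 y u.
  apply/eqP; rewrite eq_le le //=.
  have := umax u0 uy; move: eq0; rewrite /aff !dotpBl => h1 h2; lra.
by move/(proj2 (cell_aff t0A _ cu)); apply: cvx_combS; apply: finset.subsetIr.
Qed.

(** The face where [c] is maximal is the cell of [y] moved slightly against
    [c]. *)
Lemma cell_face y X : face X (cell y) -> X !=set0 -> exists d, X = cell (y - d).
Proof.
move=> [-> [] //|[c ->] _].
have [t1 t1F t1max] : exists2 t, t \in minfam p A z y &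
    forall s, s \in minfam p A z y -> dotp c (p s) <= dotp c (p t).
  have [t tF] := minfam_neq0 p z t0A y.
  by case: (@arg_maxP _ R T t (mem (minfam p A z y))
    (fun s => dotp c (p s)) tF) => r; exists r.
rewrite (argmax_cvx t1max); last by exists t1.
have [|a a0 /(_ a)] := ray_small t0A t1max; first by exists t1.
by rewrite a0 lexx => /(_ isT) E; exists (a *: c); rewrite /cell E.
Qed.

Lemma cell_cap_min y y' : cell y `&` cell y' =
  [set u | cvx_comb p (minfam p A z y :&: minfam p A z y')%SET u].
Proof.
apply/seteqP; split=> u /=; first by case=> uy uy'; exact: (cell_cap t0A uy uy').
by move=> h; split; apply: cvx_combS h; [exact: finset.subsetIl | exact: finset.subsetIr].
Qed.

Context (kappa : R) (kappa0 : kappa != 0).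
Context (sum_p : forall t, t \in A -> \sum_s p t s = kappa).
Context (S0 : (0 < #|S|)%N).

Lemma constantP (e : vec R S) : constant e <-> e \in <[[ffun=> 1] : vec R S]>%VS.
Proof.
have [i _] := card_gt0P S0.
split=> [ce|/vlineP[a ->]]; last by apply: constantZ; apply: constant_cst.
apply/vlineP; exists (e i); apply/ffunP => j.
by rewrite !ffunE [_ *: _]mulr1 (ce j i).
Qed.

Lemma dim_ones : \dim <[[ffun=> 1] : vec R S]> = 1%N.
Proof.
have [i _] := card_gt0P S0; rewrite dim_vline.
suff -> : ([ffun=> 1] : vec R S) != 0 by [].
by apply/eqP => /ffunP /(_ i); rewrite !ffunE => /eqP; rewrite oner_eq0.
Qed.

Lemma full_affdim y : full p A z y -> affdim (cell y) (#|S| - 1).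
Proof.
move=> fy; have [U [memU _]] := orth_dim p (minfam_neq0 p z t0A y).
suff -> : U = <[[ffun=> 1] : vec R S]>%VS by rewrite dim_ones.
apply/vspaceP => e; apply/idP/idP => [/memU/fy/constantP //|/constantP ce].
apply/memU; apply: orth_toS (minfam_sub p A z y) _.
exact: (constant_orth sum_p).
Qed.

Lemma edge_affdim y y' : edge p A z y y' -> affdim (cell y `&` cell y') (#|S| - 2).
Proof.
move=> [d [capN nd od dray]]; rewrite cell_cap_min.
have [U [memU _]] := orth_dim p capN.
suff -> : \dim U = 2%N by [].
have -> : U = (<[[ffun=> 1] : vec R S]> + <[d]>)%VS.
  apply/vspaceP => e; apply/idP/idP => [/memU/dray[a /constantP ce]|].
    by rewrite -[e](subrK (a *: d)) memv_add // memvZ // memv_line.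
  move=> /memv_addP[e1 /constantP ce1 [_ /vlineP[a ->] ->]].
  apply/memU => s t sF tF; rewrite !dotpDl !dotpZl (od s t) //; congr (_ + _).
  apply: (orth_toS _ (constant_orth sum_p ce1)) sF tF.
  exact: fintype.subset_trans (finset.subsetIl _ _) (minfam_sub p A z y).
rewrite dimv_disjoint_sum ?dim_ones ?dim_vline.
  suff -> : d != 0 by [].
  by apply: contra_notN nd => /eqP -> i j; rewrite !ffunE.
apply/eqP; rewrite -subv0; apply/subvP => e /memv_capP[/constantP ce /vlineP[a ea]].
have [a0|a0] := eqVneq a 0; first by rewrite ea a0 scale0r mem0v.
exfalso; apply: nd; have -> : d = a^-1 *: e by rewrite ea scalerA mulVf // scale1r.
exact: constantZ.
Qed.

End CellGeometry.

(** * Exchanges between matchings *)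

Section Exchange.
Context {I T : finType}.
Implicit Types (m : I -> T) (J : {set I}) (B : {set T}).

Definition im m : {set T} := [set m i | i : I]%SET.

Definition swap_on J m1 m2 : I -> T := fun i => if i \in J then m2 i else m1 i.

Lemma im_memP m t : reflect (exists i, t = m i) (t \in im m).
Proof.
by apply: (iffP imsetP) => [[i _ ->]|[i ->]]; [exists i | exists i].
Qed.

Lemma mem_im m i : m i \in im m.
Proof. by apply/im_memP; exists i. Qed.

Lemma card_im m : injective m -> #|im m| = #|I|.
Proof. by move=> mI; rewrite card_imset. Qed.

(** [J] is the set of rows met when following the alternating path of the
    two matchings from the column [m1 i0]; the path ends at a column used by
    [m2] only. *)
Lemma exchange m1 m2 i0 : injective m1 -> injective m2 -> m1 i0 \notin im m2 ->
  exists J t, [/\ injective (swap_on J m1 m2) /\ injective (swap_on J m2 m1),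
    t \in im m2, t \notin im m1,
    im (swap_on J m1 m2) = (t |: (im m1 :\ m1 i0))%SET &
    im (swap_on J m2 m1) = (m1 i0 |: (im m2 :\ t))%SET].
Proof.
move=> I1 I2 N0; pose e : rel I := fun i i' => m2 i == m1 i'.
pose J := [set i | connect e i0 i]%SET.
have J0 : i0 \in J by rewrite finset.in_set connect0.
have Jnext i i' : i \in J -> m2 i = m1 i' -> i' \in J.
  rewrite !finset.in_set => ci E; apply: connect_trans ci _.
  by apply: connect1; apply/eqP.
have Jprev i : i \in J -> i != i0 -> exists2 i', i' \in J & m2 i' = m1 i.
  rewrite finset.in_set => /connectP[q]; case/lastP: q => [_ -> /eqP //|q x].
  rewrite rcons_path last_rcons => /andP[pq /eqP E] -> _.
  by exists (last i0 q) => //; rewrite finset.in_set; apply/connectP; exists q.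
have N0' i : m2 i != m1 i0.
  by apply: contra N0 => /eqP <-; apply: mem_im.
have inj1 : injective (swap_on J m1 m2).
  move=> i i'; rewrite /swap_on.
  case: (boolP (i \in J)) (boolP (i' \in J)) => iJ [] i'J E.
  - exact: I2.
  - by rewrite (Jnext _ _ iJ E) in i'J.
  - by rewrite (Jnext _ _ i'J (esym E)) in iJ.
  - exact: I1.
have back i i' : i \in J -> m1 i = m2 i' -> i' \in J.
  move=> iJ E; have [i_0|i_0] := eqVneq i i0.
    by have := N0' i'; rewrite -E i_0 eqxx.
  by have [i2 i2J E2] := Jprev i iJ i_0; rewrite -(I2 _ _ (etrans E2 E)).
have inj2 : injective (swap_on J m2 m1).
  move=> i i'; rewrite /swap_on.
  case: (boolP (i \in J)) (boolP (i' \in J)) => iJ [] i'J E.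
  - exact: I1.
  - by rewrite (back _ _ iJ E) in i'J.
  - by rewrite (back _ _ i'J (esym E)) in iJ.
  - exact: I2.
have [i1 i1J i1N] : exists2 i, i \in J & m2 i \notin im m1.
  apply/exists_inP; apply: contraT; rewrite negb_exists_in => /forall_inP h.
  have : m2 @: J \subset m1 @: (J :\ i0)%SET.
    apply/fintype.subsetP => _ /imsetP[i iJ ->].
    have /negPn/im_memP[i' E] := h i iJ; rewrite E; apply: imset_f.
    rewrite finset.in_setD1 (Jnext _ _ iJ E) andbT.
    by apply: contraNneq (N0' i) => <-; rewrite E.
  move/subset_leq_card; rewrite !card_imset //.
  by rewrite [X in (X <= _)%N -> _](cardsD1 i0) J0 ltnn.
have JE : m1 @: (J :\ i0)%SET = m2 @: (J :\ i1)%SET.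
  apply/eqP; rewrite eqEcard !card_imset //; apply/andP; split.
    apply/fintype.subsetP => x /imsetP[i]; rewrite finset.in_setD1.
    move=> /andP[i_0 iJ] ->.
    have [i2 i2J E2] := Jprev i iJ i_0; rewrite -E2; apply: imset_f.
    rewrite finset.in_setD1 i2J andbT.
    by apply: contraNneq i1N => <-; rewrite E2 mem_im.
  have := cardsD1 i1 J; rewrite (cardsD1 i0 J) J0 i1J !add1n => -[->].
  exact: leqnn.
exists J, (m2 i1); split => //; first exact: mem_im.
- apply/eqP; rewrite eq_sym eqEcard card_im //; apply/andP; split.
    apply/fintype.subsetP => x /setU1P[->|/setD1P[x0 /im_memP[i xi]]].
      by apply/im_memP; exists i1; rewrite /swap_on i1J.
    subst x; have [iJ|iJ] := boolP (i \in J); last first.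
      by apply/im_memP; exists i; rewrite /swap_on (negPf iJ).
    have [|i2 i2J <-] := Jprev i iJ; first by apply: contraNneq x0 => ->.
    by apply/im_memP; exists i2; rewrite /swap_on i2J.
  rewrite cardsU1 !finset.inE (negPf i1N) andbF /=.
  by have := cardsD1 (m1 i0) (im m1); rewrite mem_im card_im // => ->.
- apply/eqP; rewrite eq_sym eqEcard card_im //; apply/andP; split.
    apply/fintype.subsetP => x /setU1P[->|/setD1P[x0 /im_memP[i xi]]].
      by apply/im_memP; exists i0; rewrite /swap_on J0.
    subst x; have [iJ|iJ] := boolP (i \in J); last first.
      by apply/im_memP; exists i; rewrite /swap_on (negPf iJ).
    have : m2 i \in m2 @: (J :\ i1)%SET.
      apply: imset_f; rewrite finset.in_setD1 iJ andbT.
      by apply: contraNneq x0 => ->.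
    rewrite -JE => /imsetP[i2]; rewrite finset.in_setD1 => /andP[_ i2J] ->.
    by apply/im_memP; exists i2; rewrite /swap_on i2J.
  rewrite cardsU1 finset.in_setD1 (negPf N0) andbF /=.
  by have := cardsD1 (m2 i1) (im m2); rewrite mem_im card_im // => ->.
Qed.

Lemma card_matching B : #|B| = #|I| -> exists2 m, injective m & im m = B.
Proof.
move=> BI; pose m i := enum_val (cast_ord (esym BI) (enum_rank i)).
have mI : injective m.
  by move=> i i' /enum_val_inj /cast_ord_inj /enum_rank_inj.
exists m => //; apply/eqP; rewrite eqEcard card_im // BI leqnn andbT.
by apply/fintype.subsetP => _ /im_memP[i ->]; apply: enum_valP.
Qed.

End Exchange.

(** * Tropical determinants *)

Lemma sum_swap_on {R : realType} {I T : finType} (c : I -> T -> R) (J : {set I}) m1 m2 :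
  \sum_i c i (swap_on J m1 m2 i) + \sum_i c i (swap_on J m2 m1 i) =
  \sum_i c i (m1 i) + \sum_i c i (m2 i).
Proof.
rewrite -!big_split; apply: eq_bigr => i _ /=; rewrite /swap_on.
by case: ifP => // _; rewrite addrC.
Qed.

Section MatchingValue.
Context {R : realType} {I T : finType}.
Implicit Types (c : I -> T -> R) (w : {set T} -> R) (B : {set T}).

(** [w B] is the tropical determinant of the columns [B] of the matrix [c], for
    [B] with as many elements as there are rows. *)
Definition matching_value c w : Prop :=
  (forall m, injective m -> w (im m) <= \sum_i c i (m i)) /\
  (forall B, #|B| = #|I| -> exists m,
     [/\ injective m, im m = B & \sum_i c i (m i) = w B]).

Lemma matching_value_exists c : exists w, matching_value c w.
Proof.
have /choice[w wP] : forall B, exists a : R,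
   (forall m, injective m -> im m = B -> a <= \sum_i c i (m i)) /\
   (#|B| = #|I| -> exists m, [/\ injective m, im m = B & \sum_i c i (m i) = a]).
  move=> B; have [BI|BN] := pselect (#|B| = #|I|); last first.
    by exists 0; split=> // m mI mB; case: BN; rewrite -mB card_im.
  have [m0 m0I m0B] := card_matching BI.
  pose Q (f : {ffun I -> T}) := injectiveb f && (im f == B).
  have imE m : im [ffun i => m i] = im m.
    by apply: eq_imset => i; rewrite ffunE.
  have Q0 : Q [ffun i => m0 i].
    rewrite /Q imE m0B eqxx andbT; apply/injectiveP => i j.
    by rewrite !ffunE => /m0I.
  case: (@arg_minP _ R _ _ Q (fun f => \sum_i c i (f i)) Q0) => f.
  move=> /andP[/injectiveP fI /eqP fB] fmin.
  exists (\sum_i c i (f i)); split=> [m mI mB|_]; last by exists f.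
  have QE : Q [ffun i => m i].
    rewrite /Q imE mB eqxx andbT; apply/injectiveP => i j.
    by rewrite !ffunE => /mI.
  apply: le_trans (fmin _ QE) _.
  by under eq_bigr => i _ do rewrite ffunE.
exists w; split=> [m mI|B]; first exact: (proj1 (wP _)).
exact: (proj2 (wP B)).
Qed.

Lemma matching_value_shift c w (y : T -> R) : matching_value c w ->
  matching_value (fun i t => c i t - y t) (fun B => w B - \sum_(t in B) y t).
Proof.
have sumE m : injective m -> \sum_(t in im m) y t = \sum_i y (m i).
  move=> mI; rewrite big_imset => [|i j _ _ /mI //].
  by apply: eq_bigl => i.
move=> [w1 w2]; split=> [m mI|B BI].
  by rewrite sumrB sumE // lerD2r w1.
have [m [mI mB mw]] := w2 B BI; exists m; split=> //.
by rewrite sumrB mw -mB sumE.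
Qed.

Lemma value_exchange c w B1 B2 x : matching_value c w ->
  #|B1| = #|I| -> #|B2| = #|I| -> x \in (B1 :\: B2)%SET ->
  exists2 t, t \in (B2 :\: B1)%SET &
    w (t |: (B1 :\ x))%SET + w (x |: (B2 :\ t))%SET <= w B1 + w B2.
Proof.
move=> [w1 w2] /w2[m1 [I1 <- <-]] /w2[m2 [I2 <- <-]].
rewrite finset.in_setD => /andP[xN /im_memP[i0 xi]]; subst x.
have [J [t [[J1 J2] t2 t1 E1 E2]]] := exchange I1 I2 xN.
exists t; first by rewrite finset.in_setD t1.
by rewrite -E1 -E2 -(sum_swap_on c J) lerD // w1.
Qed.

(** If no column is needed by all the optimal matchings, then each row is
    matched to one of its cheapest columns.  For suppose that a row strictly
    prefers [t]; a second copy of [t] would then lower the optimum.  But an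
    exchange with an optimal matching that avoids [t] distributes the two
    copies over two matchings with the original columns. *)
Lemma no_envy c w m : matching_value c w -> injective m ->
  \sum_i c i (m i) = w (im m) ->
  (forall B, #|B| = #|I| -> w (im m) <= w B) ->
  (forall t, exists B, [/\ #|B| = #|I|, t \notin B & w B <= w (im m)]) ->
  forall i t, c i (m i) <= c i t.
Proof.
move=> [w1 w2] mI mw wmin avoid i0 t; rewrite leNgt; apply/negP => lt.
have [B [BI tB Bw]] := avoid t; have [m' [m'I m'B m'w]] := w2 B BI.
(* [None] is the second copy of [t]. *)
pose m1 i := if i == i0 then None else Some (m i).
pose m2 i := Some (m' i).
have I1 : injective m1.
  move=> i j; rewrite /m1; case: eqP => [->|_]; case: eqP => [->|_] //.
  by move=> [/mI].
have I2 : injective m2 by move=> i j [/m'I].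
have m1i0 : m1 i0 = None by rewrite /m1 eqxx.
have N0 : m1 i0 \notin im m2.
  by rewrite m1i0; apply/negP => /im_memP[].
have [J [r [[J1 J2] r2 r1 E1 E2]]] := exchange I1 I2 N0.
pose c' i (o : option T) := c i (odflt t o).
have wle (g : I -> option T) : injective g ->
    (Some t \notin im g) || (None \notin im g) -> w (im m) <= \sum_i c' i (g i).
  move=> gI gN.
  have inj : injective (fun i => odflt t (g i)).
    move=> i j E; apply: gI; move: E (mem_im g i) (mem_im g j).
    case: (g i) (g j) => [a|] [b|] //= E; subst => //;
      by move=> h1 h2; rewrite h1 h2 in gN.
  by apply: le_trans (w1 _ inj); apply: wmin; rewrite card_im.
have := wle _ J1; have := wle _ J2.
have N1 : None \notin im (swap_on J m1 m2).
  rewrite E1 !finset.inE m1i0 eqxx orbF.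
  by apply: contraNneq N0 => rN; rewrite m1i0 rN.
have N2 : Some t \notin im (swap_on J m2 m1).
  rewrite E2 !finset.inE m1i0 /= negb_and; apply/orP; right.
  by apply/negP => /im_memP[i [ti]]; rewrite ti -m'B mem_im in tB.
rewrite N1 N2 orbT /= => /(_ isT) h2 /(_ isT) h1.
have := sum_swap_on c' J m1 m2.
have -> : \sum_i c' i (m2 i) = w B by rewrite -m'w.
have -> : \sum_i c' i (m1 i) = w (im m) - c i0 (m i0) + c i0 t.
  rewrite -mw (bigD1 i0) //= [in RHS](bigD1 i0) //= m1i0 /c' /=.
  rewrite (eq_bigr (fun i => c i (m i))) => [|i /negPf ni]; last by rewrite /m1 ni.
  by ring.
move=> E; lra.
Qed.

End MatchingValue.

(** * Transversal matroids with large blocks *)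

Section Transversal.
Context {S : finType} {k : nat}.
Implicit Types (Sb : 'I_k -> {set S}) (G : rel 'I_k) (B : {set S}).

Definition row_set Sb G (j : 'I_k) : {set S} :=
  (Sb j :|: \bigcup_(l | G j l) Sb l)%SET.

Lemma indep_uniform1 (E X : {set S}) : indep (uniform 1 E) X ->
  (X \subset E) && (#|X| <= 1)%N.
Proof.
move=> /exists_inP[B]; rewrite finset.in_set => /andP[BE /eqP B1] XB.
by rewrite (fintype.subset_trans XB BE) -B1 subset_leq_card.
Qed.

Lemma indep_set1 (E : {set S}) x : x \in E -> indep (uniform 1 E) [set x]%SET.
Proof.
move=> xE; apply/exists_inP; exists [set x]%SET => //.
by rewrite finset.in_set finset.sub1set xE cards1 eqxx.
Qed.

Lemma card_bigcup_le (Q : pred 'I_k) (X : 'I_k -> {set S}) :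
  (forall j, #|X j| <= 1)%N -> (#|\bigcup_(j | Q j) X j|%SET <= #|Q|)%N.
Proof.
move=> X1; rewrite -(sum1_card Q).
elim/big_ind2: _ => [|A a B b Aa Bb|j _]; first by rewrite cards0.
  by rewrite (leq_trans (leq_card_setU _ _)) // leq_add.
exact: X1.
Qed.

(** A block with at least [k] elements always has a spare one, so a maximal
    partial transversal matches every row. *)
Lemma GammaP Sb G B : (forall j, (k <= #|Sb j|)%N) ->
  B \in Gamma Sb G <->
  exists m, [/\ injective m, forall j, m j \in row_set Sb G j & im m = B].
Proof.
move=> Sbk; rewrite finset.in_set.
set P := fun A : {set S} => _.
have Ple A : P A -> (#|A| <= k)%N.
  move=> /existsP[X /andP[/forallP XI /eqP ->]].
  apply: leq_trans (card_bigcup_le xpredT _) _; last by rewrite card_ord.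
  by move=> j; have /andP[] := indep_uniform1 (XI j).
split=> [/maxsetP[/existsP[X /andP[/forallP XI /eqP BX]] Bmax]|[m [mI mE mB]]].
  have XE j : X j \subset row_set Sb G j.
    by have /andP[] := indep_uniform1 (XI j).
  have X1 j : (#|X j| <= 1)%N by have /andP[] := indep_uniform1 (XI j).
  (* Each row covers an element that no other row covers: otherwise its set
     could be replaced by a spare element of the block. *)
  have /choice[m mP] : forall j, exists x, x \in X j /\
      forall i, i != j -> x \notin X i.
    move=> j; apply: contrapT => /forallNP h.
    have Bj : B = (\bigcup_(i | i != j) X i)%SET.
      apply/eqP; rewrite finset.eqEsubset; apply/andP; split; last first.
        by rewrite BX; apply/bigcupsP => i _; apply: (finset.bigcup_sup i).
      rewrite BX; apply/fintype.subsetP => x /finset.bigcupP[i _ xi].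
      have [ij|ij] := eqVneq i j; last by apply/finset.bigcupP; exists i.
      subst i; apply: contrapT => xN; apply: (h x); split=> // i ij.
      apply/negP => xi'; apply: xN; apply/finset.bigcupP; by exists i.
    have Blt : (#|B| < k)%N.
      rewrite Bj (leq_ltn_trans (card_bigcup_le _ X1)) //.
      rewrite -[ltnRHS]card_ord; apply: proper_card.
      apply/properP; split; first by apply/fintype.subsetP.
      by exists j; rewrite // unfold_in eqxx.
    have [s sj sB] : exists2 s, s \in Sb j & s \notin B.
      apply/fintype.subsetPn; apply: contraTN Blt => /subset_leq_card.
      by rewrite -leqNgt; apply: leq_trans.
    have : (s |: B)%SET = B.
      apply: Bmax; last exact: finset.subsetUr.
      apply/existsP; exists [ffun i => if i == j then [set s]%SET else X i].
      apply/andP; split.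
        apply/forallP => i; rewrite ffunE; case: eqP => [->|_]; last exact: XI.
        by apply: indep_set1; rewrite finset.in_setU sj.
      rewrite [X in _ == X](bigD1 j) //= ffunE eqxx Bj.
      by apply/eqP; congr (_ :|: _)%SET; apply: eq_bigr => i /negPf ij; rewrite ffunE ij.
    by move=> E; move: sB; rewrite -E finset.in_setU1 eqxx.
  have Xm j : X j = [set m j]%SET.
    apply/eqP; rewrite eq_sym eqEcard cards1 X1 finset.sub1set andbT.
    exact: (proj1 (mP j)).
  exists m; split.
  - move=> i j E; apply/eqP; apply: contraT => ij.
    by have := (proj2 (mP j)) i ij; rewrite -E (proj1 (mP i)).
  - by move=> j; apply: (fintype.subsetP (XE j)); apply: (proj1 (mP j)).
  - rewrite BX; apply/finset.setP => x; apply/im_memP/finset.bigcupP.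
      by move=> [j ->]; exists j => //; apply: (proj1 (mP j)).
    by move=> [j _]; rewrite Xm => /set1P ->; exists j.
have PB : P B.
  apply/existsP; exists [ffun j => [set m j]%SET]; apply/andP; split.
    by apply/forallP => j; rewrite ffunE; apply: indep_set1; apply: mE.
  rewrite -mB; apply/eqP/finset.setP => x; apply/im_memP/finset.bigcupP.
    by move=> [j ->]; exists j => //; rewrite ffunE finset.in_set1.
  by move=> [j _]; rewrite ffunE => /set1P ->; exists j.
apply/maxsetP; split=> // A PA BA; apply/eqP.
by rewrite eq_sym eqEcard BA -mB card_im // card_ord Ple.
Qed.

End Transversal.

(** * The tropical linear space of a uniform valuated matroid *)

Section UniformLinearSpace.
Context {R : realType} {S : finType} {k : nat}.
Implicit Types (B : {set S}) (x y e : vec R S) (z : {set S} -> R).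

Local Notation U := (uniform k [set: S]%SET).

Lemma mem_uniform B : (B \in U) = (#|B| == k).
Proof. by rewrite finset.in_set finset.subsetT. Qed.

(** The polytope of a dual matroid is the hull of these vectors, for the bases
    [B] of the matroid.  Pairing with them turns the weights [z B - y(B)] into
    the weights of a point configuration, up to the constant [y(S)]. *)
Definition co_indicator B : vec R S := indicator (~: B)%SET.

Lemma co_indicatorE B s : co_indicator B s = (s \notin B)%:R.
Proof. by rewrite ffunE finset.in_setC. Qed.

Lemma dotp_co_indicator e B :
  dotp e (co_indicator B) = \sum_s e s - \sum_(s in B) e s.
Proof.
rewrite (bigID [in B]) /= addrC addrK [RHS]big_mkcond.
apply: eq_bigr => s _; rewrite co_indicatorE.
by case: (s \in B); rewrite ?mulr0 ?mulr1.
Qed.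

Lemma min_basesE z y : min_bases U z y = minfam co_indicator U z y.
Proof.
apply/finset.setP => B; rewrite !finset.in_set; congr (_ && _).
apply: eq_forallb_in => B' _; rewrite /wt !dotp_co_indicator.
by rewrite !(addrCA (z _)) lerD2l.
Qed.

Lemma min_basesP z y B : reflect
  (#|B| = k /\ forall B', #|B'| = k ->
     z B - \sum_(s in B) y s <= z B' - \sum_(s in B') y s)
  (B \in min_bases U z y).
Proof.
rewrite finset.in_set mem_uniform.
apply: (iffP andP) => [[/eqP BI /forall_inP h]|[BI h]].
  by split=> // B' B'I; apply: h; rewrite mem_uniform B'I.
by split; [rewrite BI | apply/forall_inP => B'; rewrite mem_uniform => /eqP /h].
Qed.

Lemma base_polytope_dual (M : {set {set S}}) :
  base_polytope (dual_matroid M) = [set u : vec R S | cvx_comb co_indicator M u].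
Proof.
rewrite -conv_hullP /base_polytope; congr conv_hull.
apply/seteqP; split=> [_ [B /= /imsetP[B' B'M ->] <-]|_ [B /= BM <-]].
  by exists B'.
by exists (~: B)%SET => //=; apply: imset_f.
Qed.

(** The vertices of a cube are in convex position. *)
Lemma co_indicator_extreme (M : {set {set S}}) B :
  cvx_comb co_indicator M (co_indicator B) -> B \in M.
Proof.
move=> [l [l0 lM l1 E]].
have [B' lB'] : exists B', l B' != 0.
  apply/existsP; apply: contraT; rewrite negb_exists => /forallP h.
  move: l1; rewrite big1 => [/esym/eqP|B' _]; first by rewrite oner_eq0.
  by have := h B'; rewrite negbK => /eqP.
suff E' s : (s \in B') = (s \in B).
  suff <- : B' = B by apply: contraR lB' => /lM ->.
  exact/finset.setP.
have Es : (co_indicator B s : R) = \sum_C l C * co_indicator C s.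
  rewrite {1}E sum_ffunE; apply: eq_bigr => C _; by rewrite ffunE.
move: Es; rewrite co_indicatorE; case: (boolP (s \in B)) => sB Es.
  have le0 C : l C != 0 -> - (co_indicator C s : R) <= 0.
    by rewrite co_indicatorE oppr_le0 ler0n.
  have [_ h] := avg_le l0 l1 le0.
  have /h /(_ B' lB') : \sum_C l C * - co_indicator C s = 0.
    by under eq_bigr do rewrite mulrN; rewrite sumrN -Es oppr0.
  by move/eqP; rewrite co_indicatorE oppr_eq0 pnatr_eq0 eqb0 negbK.
have le1 C : l C != 0 -> (co_indicator C s : R) <= 1.
  by rewrite co_indicatorE; case: (_ \notin _); rewrite ?ler01.
have [_ /(_ (esym Es) B' lB')] := avg_le l0 l1 le1.
by rewrite co_indicatorE; case: (s \in B') => //= /eqP; rewrite eq_sym oner_eq0.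
Qed.

Lemma cvx_co_indicator_sub (M N : {set {set S}}) :
  [set u : vec R S | cvx_comb co_indicator M u] `<=`
  [set u | cvx_comb co_indicator N u] -> M \subset N.
Proof.
move=> h; apply/fintype.subsetP => B BM; apply: co_indicator_extreme.
by apply: h; apply: cvx_comb1.
Qed.

(** The exchange axiom of valuated matroids of uniform type. *)
Definition valuated z : Prop := forall B1 B2 s,
  #|B1| = k -> #|B2| = k -> s \in (B1 :\: B2)%SET ->
  exists2 t, t \in (B2 :\: B1)%SET &
    z (t |: (B1 :\ s))%SET + z (s |: (B2 :\ t))%SET <= z B1 + z B2.

Lemma card_exchange B s t : s \in B -> t \notin B -> #|t |: (B :\ s)|%SET = #|B|.
Proof.
move=> sB tB; rewrite cardsU1 !finset.inE (negPf tB) andbF /=.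
by rewrite [RHS](cardsD1 s) sB.
Qed.

Lemma sum_exchange x B s t : s \in B -> t \notin B ->
  \sum_(r in (t |: (B :\ s))%SET) x r = \sum_(r in B) x r - x s + x t.
Proof.
move=> sB tB; rewrite big_setU1 /=; last by rewrite !finset.inE (negPf tB) andbF.
by rewrite [in RHS](big_setD1 s) //= [x s + _]addrC addrK addrC.
Qed.

Lemma rk_uniform : (k <= #|S|)%N -> rk U = k.
Proof.
move=> kS; apply/eqP; rewrite eqn_leq; apply/andP; split.
  apply/bigmax_leqP => B; rewrite mem_uniform => /eqP <-.
  by apply: subset_leq_card; apply: finset.subsetIr.
have [B BS Bk] : exists2 B : {set S}, B \subset [set: S]%SET & #|B| = k.
  exists [set s in take k (enum S)]%SET; first exact: finset.subsetT.
  rewrite cardsE (card_uniqP _) ?take_uniq ?enum_uniq // size_takel //.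
  by rewrite -cardE.
rewrite -[X in (X <= _)%N]Bk (leq_trans _ (leq_bigmax_cond B _)) //.
  by rewrite finset.setTI.
by rewrite mem_uniform Bk.
Qed.

Lemma min_twiceP (J : {set S}) (f : S -> R) i j : i \in J ->
  (forall r, r \in J -> f i <= f r) -> j \in J -> j != i -> f j <= f i ->
  min_twice J f.
Proof.
move=> iJ imin jJ ji fji; right.
apply: leq_trans (_ : #|[set i; j]%SET| <= _)%N; first by rewrite cards2 eq_sym ji.
apply/subset_leq_card/fintype.subsetP => r /set2P[->|->]; rewrite finset.in_set.
  by rewrite iJ; apply/forall_inP.
by rewrite jJ; apply/forall_inP => l /imin; apply: le_trans.
Qed.

(** A minimizing [j] is exchanged between [j |: sigma] and [tau :\ j]; the
    element received in return is a second minimizer. *)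
Lemma valuated_Dressian z : (k <= #|S|)%N -> valuated z -> Dressian U z.
Proof.
move=> kS vz sigma tau _; rewrite rk_uniform // => sk _ tk.
move=> /fintype.subsetPn[]; set J := [set j in tau | _]%SET.
have JE j : j \in J -> [/\ j \in tau, #|(j |: sigma)%SET| = k & #|(tau :\ j)%SET| = k].
  by rewrite finset.in_set !mem_uniform => /and3P[? /eqP ? /eqP ?].
set f := fun j => _; move=> s0 s0s s0t; have [->|[j0 j0J]] := set_0Vmem J; first by left.
case: (@arg_minP _ R _ j0 (mem J) f j0J) => j jJ jmin.
have [jt jc tc] := JE j jJ.
have js : j \notin sigma.
  apply/negP => js; move: jc; rewrite cardsU1 js -sk => /eqP.
  by rewrite add0n -[X in (X == _)]addn0 -addn1 eqn_add2l.
have [|t] := vz (j |: sigma)%SET (tau :\ j)%SET j jc tc.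
  by rewrite !finset.inE eqxx.
rewrite finset.in_setD finset.in_setU1 negb_or finset.in_setD1.
move=> /andP[/andP[tj ts] /andP[_ tt]] le.
have E1 : (t |: ((j |: sigma) :\ j) = t |: sigma)%SET.
  by rewrite setU1K.
have E2 : (j |: ((tau :\ j) :\ t) = tau :\ t)%SET.
  apply/finset.setP => r; rewrite !finset.inE.
  by have [->|] := eqVneq r j; rewrite ?jt ?andbT //= eq_sym tj.
rewrite E1 E2 in le.
have tJ : t \in J.
  rewrite finset.in_set tt !mem_uniform cardsU1 ts add1n sk eqxx /=.
  by have := cardsD1 t tau; rewrite tt tk add1n => -[<-].
exact: (min_twiceP jJ jmin tJ tj le).
Qed.

(** If [s] is a loop of the initial matroid and [B] one of its bases, then [B]
    is the only cheapest basis contained in [s |: B].  Conversely, a cheapest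
    basis contained in [tau] can be exchanged with an initial basis through the
    element of [tau] that it misses, which gives a second cheapest one. *)
Lemma trop_linear_spaceP z x : (k < #|S|)%N -> valuated z ->
  trop_linear_space U z x <->
  forall s, exists2 B, B \in min_bases U z x & s \in B.
Proof.
move=> kS vz; have kS' := ltnW kS.
have [B0 B0m] : exists B, B \in min_bases U z x.
  have [B Bk] : exists B : {set S}, #|B| == k.
    exists [set s in take k (enum S)]%SET.
    rewrite cardsE (card_uniqP _) ?take_uniq ?enum_uniq // size_takel //.
    by rewrite -cardE.
  case: (@arg_minP _ R _ B (fun B => #|B| == k)
    (fun B => z B - \sum_(s in B) x s) Bk) => C /eqP Ck Cmin.
  by exists C; apply/min_basesP; split=> // B' /eqP /Cmin.
have fE (tau : {set S}) j : j \in tau ->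
    z (tau :\ j)%SET + x j =
    (z (tau :\ j)%SET - \sum_(s in (tau :\ j)%SET) x s) + \sum_(s in tau) x s.
  by move=> jt; rewrite (big_setD1 j jt) /= [x j + _]addrC addrA subrK.
have Jin (tau : {set S}) j : #|tau| = k.+1 -> j \in tau ->
    j \in [set j in tau | (tau :\ j)%SET \in U]%SET.
  move=> tk jt; rewrite finset.in_set jt mem_uniform.
  by have := cardsD1 j tau; rewrite jt tk add1n => -[E]; rewrite -E eqxx.
split=> [xL s|h tau _].
  apply: contrapT => sN; have {}sN B : B \in min_bases U z x -> s \notin B.
    by move=> Bm; apply/negP => sB; apply: sN; exists B.
  have /min_basesP[B0k B0min] := B0m; have sB0 := sN _ B0m.
  pose tau := (s |: B0)%SET.
  have tk : #|tau| = k.+1 by rewrite cardsU1 sB0 B0k.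
  have ts : (tau :\ s)%SET = B0 by rewrite setU1K.
  have stau : s \in tau by rewrite finset.in_setU1 eqxx.
  have B0t : B0 \subset tau by apply: finset.subsetUr.
  have rkt : rank U tau = rk U.
    apply/eqP; rewrite rk_uniform // eqn_leq; apply/andP; split.
      apply/bigmax_leqP => B; rewrite mem_uniform => /eqP <-.
      by apply: subset_leq_card; apply: finset.subsetIr.
    rewrite -[X in (X <= _)%N]B0k (leq_trans _ (leq_bigmax_cond B0 _)) //.
      by rewrite (finset.setIidPr B0t).
    by rewrite mem_uniform B0k.
  have := xL tau rkt; rewrite rk_uniform // => /(_ tk)[J0|].
    by have := Jin tau s tk stau; rewrite J0 finset.in_set0.
  set D := [set i in _ | _]%SET => D2.
  have [j jD js] : exists2 j, j \in D & j != s.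
    have : (0 < #|D :\ s|%SET)%N.
      by move: D2; rewrite (cardsD1 s); case: (s \in D); rewrite ?add1n ?add0n // => /ltnW.
    by case/card_gt0P => j /setD1P[js jD]; exists j.
  move: jD; rewrite finset.in_set => /andP[jJ /forall_inP /(_ s (Jin _ _ tk stau))].
  have jt : j \in tau by move: jJ; rewrite finset.in_set => /andP[].
  rewrite !fE // lerD2r ts => le.
  suff /sN : (tau :\ j)%SET \in min_bases U z x.
    by rewrite finset.in_setD1 eq_sym js stau.
  apply/min_basesP; split=> [|B' /B0min]; last exact: le_trans.
  by have := cardsD1 j tau; rewrite jt tk add1n => -[<-].
rewrite rk_uniform // => tk.
set J := [set j in tau | _]%SET; set f := fun j => _.
have [->|[j0 j0J]] := set_0Vmem J; first by left.
case: (@arg_minP _ R _ j0 (mem J) f j0J) => j jJ jmin.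
have := jJ : j \in J; rewrite finset.in_set mem_uniform => /andP[jt /eqP jk].
have [B Bm jB] := h j; have /min_basesP[Bk Bmin] := Bm.
have [|t] := vz B (tau :\ j)%SET j Bk jk.
  by rewrite !finset.inE jB eqxx.
rewrite finset.in_setD finset.in_setD1 => /and3P[tB tj tt] le.
have E2 : (j |: ((tau :\ j) :\ t) = tau :\ t)%SET.
  apply/finset.setP => r; rewrite !finset.inE.
  by have [->|] := eqVneq r j; rewrite ?jt ?andbT //= eq_sym tj.
have tJ : t \in J by apply: Jin.
have ftj : f t <= f j.
  have := Bmin (t |: (B :\ j))%SET; rewrite card_exchange // => /(_ Bk).
  rewrite sum_exchange // /f; rewrite E2 in le => h1.
  lra.
exact: (min_twiceP jJ jmin tJ tj ftj).
Qed.

End UniformLinearSpace.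

(** * Polytopes cut out by sectors and their linear spaces *)

Lemma closed_tconvex {R : realType} {I : finType} (X : set (vec R I)) :
  (forall a x, X x -> X (tscale a x)) -> (forall x x', X x -> X x' -> X (tmin x x')) ->
  tconvex X.
Proof.
move=> Xs Xm n a x Xx; rewrite /tcomb; elim/big_ind: _ => //; first exact: Xs.
by move=> i _; apply: Xs.
Qed.

Section SectorPolytope.
Context {R : realType} {k : nat} {S : finType}.
Context (v : 'I_k -> vec R 'I_k) (P : set (vec R 'I_k)).
Context (PE : P = \bigcap_(i in [set: 'I_k]) sector (v i) i).
Context (Pv : forall i, P (v i)).
Context (Sb : 'I_k -> {set S}) (blk : S -> 'I_k).
Context (blkP : forall s i, (s \in Sb i) = (blk s == i)).
Context (k0 : (0 < k)%N) (big : forall i, (maxn 2 k <= #|Sb i|)%N).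
Context (z : {set S} -> R).
Context (zP : matching_value (fun (i : 'I_k) s => (v i (blk s) : R)) z).
Implicit Types (x : vec R 'I_k) (y e : vec R S) (B : {set S}).

Local Notation U := (uniform k [set: S]%SET).
Local Notation Gam x := (Gamma Sb (vertex_graph v x)).

(** The isomorphism from [P] to the bounded part: each coordinate is repeated
    along its block. *)
Definition dup x : vec R S := [ffun s => x (blk s)].

Lemma sectorP x : P x <-> forall i j, (x j : R) - x i <= v i j - v i i.
Proof.
rewrite PE; split=> [h i j|h i _ j ij].
  have [->|ij] := eqVneq j i; first by rewrite !subrr.
  by have := h i I j ij => /= hij; lra.
by have := h i j => /= hij; lra.
Qed.

Lemma vertex_graphP x i j : P x ->
  vertex_graph v x i j <-> j != i /\ (x j : R) - x i = v i j - v i i.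
Proof.
move=> Px; rewrite /vertex_graph; split=> [/andP[ji /asboolP[_ E]]|[ji E]].
  by split=> //; move: E => /= E; lra.
rewrite ji; apply/asboolP; split; last by move=> /=; lra.
by move: Px; rewrite PE; apply.
Qed.

Lemma mem_row_set x i s : P x ->
  s \in row_set Sb (vertex_graph v x) i <-> (x (blk s) : R) - x i = v i (blk s) - v i i.
Proof.
move=> Px; rewrite finset.in_setU blkP; split.
  move=> /orP[/eqP ->|/finset.bigcupP[l]]; first by rewrite !subrr.
  by move=> /(vertex_graphP _ _ Px)[_ E]; rewrite blkP => /eqP ->.
move=> E; have [//|si] := eqVneq (blk s) i; apply/orP; right.
apply/finset.bigcupP; exists (blk s); last by rewrite blkP.
by apply/(vertex_graphP _ _ Px); rewrite si.
Qed.

Lemma block_elt i (s : S) : exists2 t, t \in Sb i & t != s.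
Proof.
have : (1 < #|Sb i|)%N by apply: leq_trans (big i); rewrite leq_max leqnn.
rewrite (cardsD1 s) => lt.
have /card_gt0P[t /setD1P[ts ti]] : (0 < #|Sb i :\ s|%SET)%N.
  by case: (s \in Sb i) lt; rewrite ?add1n ?add0n // => /ltnW.
by exists t.
Qed.

Lemma blocks_k i : (k <= #|Sb i|)%N.
Proof. by apply: leq_trans (big i); rewrite leq_max leqnn orbT. Qed.

(** Only one element per block is prescribed, and each block has another one
    than the element to be avoided. *)
Lemma transversal s t : s != t -> exists m : 'I_k -> S,
  [/\ injective m, forall i, blk (m i) = i, s \in im m & t \notin im m].
Proof.
move=> st; have /choice[m mP] : forall i, exists r,
    [/\ r \in Sb i, r != t & (blk s = i -> r = s)].
  move=> i; have [si|si] := eqVneq (blk s) i.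
    by exists s; rewrite blkP si.
  have [r ri rt] := block_elt i t; exists r; split=> // E.
  by rewrite E eqxx in si.
have mB i : blk (m i) = i by have [] := mP i; rewrite blkP => /eqP.
exists m; split=> //.
- by move=> i j E; rewrite -(mB i) E mB.
- by apply/im_memP; exists (blk s); have [_ _ ->] := mP (blk s).
- by apply/im_memP => -[i E]; have [_] := mP i; rewrite E eqxx.
Qed.

Lemma two_elts (s : S) : exists t, t != s.
Proof. by have [t _ ts] := block_elt (Ordinal k0) s; exists t. Qed.

Lemma an_elt : exists s : S, true.
Proof.
have /card_gt0P[s _] : (0 < #|Sb (Ordinal k0)|)%N.
  by apply: leq_trans (blocks_k _).
by exists s.
Qed.

Lemma block_repr i : exists s, blk s = i.
Proof.
have [s0 _] := an_elt; have [s] := block_elt i s0.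
by rewrite blkP => /eqP; exists s.
Qed.

Lemma ltk : (k < #|S|)%N.
Proof.
have [s _] := an_elt; have [t ts] := two_elts s.
have [m [mI _ _ sN]] := transversal ts.
rewrite -[k]card_ord -(card_im mI) -cardsT; apply: proper_card.
by apply/properP; split; [exact: finset.subsetT | exists s].
Qed.

Lemma zval : valuated z (k := k).
Proof.
move=> B1 B2 s B1k B2k; apply: value_exchange zP _ _; by rewrite card_ord.
Qed.

Let cost y (i : 'I_k) s : R := v i (blk s) - y s.
Let wgt y B : R := z B - \sum_(s in B) y s.

Lemma wgtP y : matching_value (cost y) (wgt y).
Proof. exact: matching_value_shift zP. Qed.

Lemma transversal_Gamma x m : P x -> injective m -> (forall i, blk (m i) = i) ->
  im m \in Gam x.
Proof.
move=> Px mI mB; apply/GammaP; first exact: blocks_k.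
by exists m; split=> // i; apply/mem_row_set; rewrite ?mB ?subrr.
Qed.

(** At [dup x] the cheapest columns of row [i] are those of its own block, at
    cost [v i i - x i], and of the blocks on whose facets [x] lies; so the
    optimal matchings are the transversals of these sets. *)
Lemma min_bases_dup x : P x -> min_bases U z (dup x) = Gam x.
Proof.
move=> Px; have [w1 w2] := wgtP (dup x).
have le i s : v i i - x i <= cost (dup x) i s.
  by rewrite /cost ffunE; have /sectorP /(_ i (blk s)) := Px; lra.
have eqc i s : s \in row_set Sb (vertex_graph v x) i <->
    cost (dup x) i s = v i i - x i.
  rewrite mem_row_set // /cost ffunE; split=> E; lra.
pose a := \sum_i (v i i - x i : R).
have lea B : #|B| = k -> a <= wgt (dup x) B.
  rewrite -{1}[k]card_ord => /w2[m [_ _ <-]]; exact: ler_sum.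
have lea' m : injective m -> (forall i, m i \in row_set Sb (vertex_graph v x) i) ->
    wgt (dup x) (im m) <= a.
  move=> mI mE; apply: le_trans (w1 m mI) _; apply: ler_sum => i _.
  by rewrite (proj1 (eqc _ _)).
apply/finset.setP => B; apply/min_basesP/idP.
  move=> [Bk Bmin]; apply/(GammaP _ _ blocks_k).
  have [m [mI mB mw]] := w2 B (etrans Bk (esym (card_ord k))).
  exists m; split=> // i; apply/eqc.
  have [s _] := an_elt; have [t ts] := two_elts s.
  have [m0 [m0I m0B _ _]] := transversal ts.
  have : \sum_i cost (dup x) i (m i) <= a.
    rewrite mw; apply: le_trans (lea' m0 m0I _).
      by apply: Bmin; rewrite card_im // card_ord.
    by move=> j; apply/mem_row_set; rewrite // m0B !subrr.
  rewrite -subr_le0 -sumrB => s0.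
  have ge0 (j : 'I_k) : true -> 0 <= cost (dup x) j (m j) - (v j j - x j).
    by move=> _; rewrite subr_ge0.
  have /eqP : \sum_i (cost (dup x) i (m i) - (v i i - x i)) = 0.
    by apply/eqP; rewrite eq_le s0 sumr_ge0.
  rewrite psumr_eq0 // => /allP /(_ i (mem_index_enum i)) /=.
  by rewrite subr_eq0 => /eqP.
move=> /(GammaP _ _ blocks_k)[m [mI mE mB]].
rewrite -mB card_im // card_ord; split=> // B' B'k.
exact: le_trans (lea' m mI mE) (lea B' B'k).
Qed.

Definition loopless (M : {set {set S}}) := forall s, exists2 B, B \in M & s \in B.
Definition coloopless (M : {set {set S}}) := forall s, exists2 B, B \in M & s \notin B.

Lemma dup_loopless x : P x -> loopless (Gam x) /\ coloopless (Gam x).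
Proof.
move=> Px; split=> s; have [t ts] := two_elts s.
  have [|m [mI mB sm _]] := @transversal s t; first by rewrite eq_sym.
  by exists (im m) => //; apply: transversal_Gamma.
have [m [mI mB _ sm]] := transversal ts.
by exists (im m) => //; apply: transversal_Gamma.
Qed.

(** Without coloops every row is matched at its cheapest cost, and without
    loops every column is used, so [y] is the tropical combination of the rows
    with the opposites of these costs as coefficients. *)
Lemma loopless_dup y : loopless (min_bases U z y) -> coloopless (min_bases U z y) ->
  exists2 x, P x & y = dup x.
Proof.
move=> yl yc; have [w1 w2] := wgtP y.
have cheap s : exists i, forall t, cost y i s <= cost y i t.
  have [B Bm sB] := yl s; have /min_basesP[Bk Bmin] := Bm.
  have [m [mI mB mw]] := w2 B (etrans Bk (esym (card_ord k))).
  rewrite -mB in sB; have /im_memP[i si] := sB; exists i => t; rewrite si.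
  apply: (no_envy (wgtP y) mI); rewrite ?mB //.
    by move=> B'; rewrite card_ord => /Bmin.
  move=> r; have [B' /min_basesP[B'k B'min] rB'] := yc r.
  by exists B'; rewrite card_ord; split=> //; apply: B'min.
have blkle s t : blk s = blk t -> (y t : R) <= y s.
  by move=> E; have [i /(_ t)] := cheap s; rewrite /cost E lerD2l lerN2.
have blkE s t : blk s = blk t -> y s = y t.
  by move=> E; apply/eqP; rewrite eq_le !blkle.
have /choice[rep repP] := block_repr.
pose x : vec R 'I_k := [ffun i => y (rep i)].
have yE : y = dup x by apply/ffunP => s; rewrite !ffunE; apply: blkE; rewrite repP.
exists x => //; apply/sectorP => i j; have [l /(_ (rep j))] := cheap (rep i).
have /sectorP /(_ i j) := Pv l => h.
have /sectorP := Pv l; rewrite /cost !repP !ffunE; move: h; lra.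
Qed.

Lemma dup_inj x x' : dup x = dup x' -> x = x'.
Proof.
move=> E; apply/ffunP => i; have [s <-] := block_repr i.
by move/ffunP: E => /(_ s); rewrite !ffunE.
Qed.

Lemma tls_dup x : P x -> trop_linear_space U z (dup x).
Proof.
move=> Px; apply/(trop_linear_spaceP _ ltk zval) => s.
by rewrite min_bases_dup //; exact: (proj1 (dup_loopless Px)).
Qed.

Lemma cell_dup x y : P x -> tls_cell U z (dup x) y -> exists2 x', P x' & y = dup x'.
Proof.
move=> Px; rewrite /tls_cell /= min_bases_dup // => /fintype.subsetP sub.
have [l c] := dup_loopless Px; apply: loopless_dup => s.
  by have [B /sub] := l s; exists B.
by have [B /sub] := c s; exists B.
Qed.

Lemma cell_dup_bounded x : P x -> qbounded (tls_cell U z (dup x)).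
Proof.
move=> Px; exists (\sum_i \sum_j `|(v i j : R) - v i i|) => y /(cell_dup Px)[x' Px' ->].
have le i j : `|(v i j : R) - v i i| <= \sum_i \sum_j `|(v i j : R) - v i i|.
  rewrite (bigD1 i) //= (bigD1 j) //= -addrA lerDl addr_ge0 //; last first.
    by apply: sumr_ge0 => i' _; apply: sumr_ge0 => j' _.
  by apply: sumr_ge0 => j' _.
move=> s t; rewrite !ffunE ler_norml lerNl opprB.
have /sectorP h := Px'; apply/andP; split.
  by apply: le_trans (h _ _) _; apply: le_trans (ler_norm _) (le _ _).
by apply: le_trans (h _ _) _; apply: le_trans (ler_norm _) (le _ _).
Qed.

(** A loop or a coloop of the initial matroid gives a ray of the cell. *)
Lemma bounded_loopless y : qbounded (tls_cell U z y) ->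
  loopless (min_bases U z y) /\ coloopless (min_bases U z y).
Proof.
move=> [b hb].
have ray (s : S) (a : R) :
    tls_cell U z y (y + [ffun r => (r == s)%:R * a]) -> `|a| <= 2 * b.
  move=> h; have [t ts] := two_elts s.
  have := hb _ h s t; have := hb y (subxx _) s t.
  rewrite !ffunE eqxx (negPf ts) mul1r mul0r addr0.
  by rewrite !ler_norml => /andP[h1 h2] /andP[h3 h4]; lra.
have sumE s (a : R) B : \sum_(r in B) (y + [ffun r => (r == s)%:R * a]) r =
    \sum_(r in B) y r + (s \in B)%:R * a.
  under eq_bigr => r _ do rewrite !ffunE.
  rewrite big_split /=; congr (_ + _); rewrite big_mkcond (bigD1 s) //= eqxx.
  rewrite big1 => [|r /negPf rs]; last by rewrite rs mul0r; case: ifP.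
  by case: (s \in B); rewrite ?mul1r ?mul0r addr0.
pose a := `|2 * b| + 1.
have a0 : 0 <= a by rewrite addr_ge0.
have aN : ~ (`|a| <= 2 * b).
  by have := ler_norm (2 * b); rewrite (ger0_norm a0) /a => h1 h2; lra.
split=> s; apply: contrapT => N.
- have {}N B : B \in min_bases U z y -> s \notin B.
    by move=> Bm; apply/negP => sB; apply: N; exists B.
  apply: aN; rewrite -normrN; apply: (ray s); apply/fintype.subsetP => B Bm.
  have /min_basesP[Bk Bmin] := Bm; apply/min_basesP; split=> // B' /Bmin h.
  rewrite !sumE (negPf (N B Bm)) mul0r addr0.
  by case: (s \in B'); rewrite ?mul1r ?mul0r; lra.
- have {}N B : B \in min_bases U z y -> s \in B.
    by move=> Bm; apply: contrapT => /negP sB; apply: N; exists B.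
  apply: aN; apply: (ray s); apply/fintype.subsetP => B Bm.
  have /min_basesP[Bk Bmin] := Bm; apply/min_basesP; split=> // B' /Bmin h.
  rewrite !sumE (N B Bm) mul1r.
  by case: (s \in B'); rewrite ?mul1r ?mul0r; lra.
Qed.

Lemma bounded_part_dup : bounded_part U z = dup @` P.
Proof.
apply/seteqP; split=> [y [C [[x xL <-] /bounded_loopless[l c]] yC]|_ [x Px <-]].
  have [x' Px' xE] := loopless_dup l c; rewrite xE in yC.
  by have [x2 Px2 ->] := cell_dup Px' yC; exists x2.
exists (tls_cell U z (dup x)); last exact: subxx.
by split; [exists (dup x) => //; apply: tls_dup | apply: cell_dup_bounded].
Qed.

Lemma dup_tmin x x' : dup (tmin x x') = tmin (dup x) (dup x').
Proof. by apply/ffunP => s; rewrite !ffunE. Qed.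

Lemma dup_tscale a x : dup (tscale a x) = tscale a (dup x).
Proof. by apply/ffunP => s; rewrite !ffunE. Qed.

Lemma P_tscale a x : P x -> P (tscale a x).
Proof.
move=> /sectorP h; apply/sectorP => i j; rewrite !ffunE.
by have := h i j; lra.
Qed.

Lemma P_tmin x x' : P x -> P x' -> P (tmin x x').
Proof.
move=> /sectorP h /sectorP h'; apply/sectorP => i j; rewrite !ffunE.
have [le|lt] := leP (x i : R) (x' i).
  by have := h i j; have : Num.min (x j : R) (x' j) <= x j; [rewrite ge_min lexx | lra].
have := h' i j; have : Num.min (x j : R) (x' j) <= x' j; last lra.
by rewrite ge_min lexx orbT.
Qed.

Lemma dup_trop_iso : trop_iso P (dup @` P).
Proof.
split.
- by apply: closed_tconvex; [exact: P_tscale | exact: P_tmin].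
- apply: closed_tconvex => [a _ [x Px <-]|_ _ [x Px <-] [x' Px' <-]].
    by exists (tscale a x); [exact: P_tscale | rewrite dup_tscale].
  by exists (tmin x x'); [exact: P_tmin | rewrite dup_tmin].
- exists dup; split.
  + split=> [x Px|x x' _ _|y [x Px <-]]; [by exists x | exact: dup_inj | by exists x].
  + by move=> x x' _ _; apply: dup_tmin.
  + by move=> a x _; apply: dup_tscale.
Qed.

(** * The vertices of the polytope select the maximal cells *)

Local Notation pc := (@co_indicator R S).
Local Notation F y := (minfam pc U z y).
Local Notation cell y := [set u : vec R S | cvx_comb pc (F y) u].

Lemma F_dup x : P x -> F (dup x) = Gam x.
Proof. by move=> Px; rewrite -min_basesE min_bases_dup. Qed.

Lemma orth_sum M e B B' : orth_to pc M e -> B \in M -> B' \in M ->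
  \sum_(s in B) e s = \sum_(s in B') e s.
Proof.
by move=> h BM B'M; have := h B B' BM B'M; rewrite !dotp_co_indicator => /addrI/oppr_inj.
Qed.

Lemma sum_im (m : 'I_k -> S) e : injective m -> \sum_(s in im m) e s = \sum_i e (m i).
Proof.
move=> mI; rewrite big_imset => [|i j _ _ /mI //].
by apply: eq_bigl => i.
Qed.

Definition update (m : 'I_k -> S) i t : 'I_k -> S := fun j => if j == i then t else m j.

Lemma update_inj m i t : injective m -> (forall j, j != i -> m j != t) ->
  injective (update m i t).
Proof.
move=> mI mt j j'; rewrite /update.
have [->|ji] := eqVneq j i; have [->|j'i] := eqVneq j' i => // E.
- by have := mt _ j'i; rewrite -E eqxx.
- by have := mt _ ji; rewrite E eqxx.
- exact: mI.
Qed.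

Lemma orth_update M e m i t : orth_to pc M e -> injective m -> im m \in M ->
  (forall j, j != i -> m j != t) -> im (update m i t) \in M -> e t = e (m i).
Proof.
move=> oe mI mM mt m'M; have := orth_sum oe mM m'M.
rewrite !sum_im //; last exact: update_inj.
rewrite (bigD1 i) //= [in RHS](bigD1 i) //= /update eqxx.
rewrite [in RHS](eq_bigr (fun j => e (m j))) => [/addIr //|j /negPf ji].
by rewrite ji.
Qed.

Lemma uniform_gen e : orth_to pc U e -> constant e.
Proof.
move=> oe; suff h s t : s != t -> e t = e s.
  by move=> s t; have [->|st] := eqVneq s t; last by rewrite (h s t st).
move=> st; have [m [mI mB /im_memP[i si] tN]] := transversal st; rewrite si.
have mt j : j != i -> m j != t by move=> _; apply: contraNneq tN => <-; apply: mem_im.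
apply: (orth_update oe mI _ mt); rewrite mem_uniform card_im ?card_ord //.
exact: update_inj.
Qed.

(** Replacing one element of a transversal by another one of the same block, or
    by one of a block to which its row has an arrow, gives a basis again. *)
Lemma orth_Gamma x e : P x -> orth_to pc (Gam x) e ->
  exists2 e' : vec R 'I_k, e = dup e' & forall i c, vertex_graph v x i c -> e' c = e' i.
Proof.
move=> Px oe.
have upd m i t : injective m -> (forall j, blk (m j) = j) ->
    (forall j, j != i -> m j != t) -> t \in row_set Sb (vertex_graph v x) i ->
    e t = e (m i).
  move=> mI mB mt ti; apply: (orth_update oe mI _ mt); first exact: transversal_Gamma.
  apply/GammaP; first exact: blocks_k.
  exists (update m i t); split=> // [|j]; first exact: update_inj.
  rewrite /update; have [->//|ji] := eqVneq j i.
  by apply/mem_row_set; rewrite ?mB ?subrr.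
have eblk s t : blk s = blk t -> e s = e t.
  move=> E; have [->//|st] := eqVneq s t.
  have [m [mI mB /im_memP[i si] tN]] := transversal st; rewrite si; apply/esym/upd => //.
    by move=> j _; apply: contraNneq tN => <-; apply: mem_im.
  by rewrite finset.in_setU blkP -E si mB eqxx.
have /choice[rep repP] := block_repr.
exists [ffun i => e (rep i)].
  by apply/ffunP => s; rewrite !ffunE; apply: eblk; rewrite repP.
move=> i c ic; rewrite !ffunE.
have ci : c != i by case/andP: ic.
have repI : injective rep by move=> j j' E; rewrite -(repP j) E repP.
have [t tc tr] := block_elt c (rep c); rewrite blkP in tc.
rewrite -(eblk t (rep c)); last by rewrite repP (eqP tc).
apply: (upd rep) => //.
  move=> j ji; have [->|jc] := eqVneq j c; first by rewrite eq_sym.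
  by apply: contra_neq jc => E; rewrite -(repP j) E (eqP tc).
rewrite finset.in_setU; apply/orP; right; apply/finset.bigcupP; exists c => //.
by rewrite blkP.
Qed.

Lemma Vert_sub w : Vert P w -> P w.
Proof.
have ww : tclass w w by exists 0 => //; apply/ffunP => i; rewrite ffunE add0r.
by case=> [E|[c E]]; [rewrite E in ww | move: ww; rewrite E => -[]].
Qed.

Lemma vertex_graph_sub x x' : P x -> P x' ->
  (forall i c, vertex_graph v x i c -> vertex_graph v x' i c) -> Gam x \subset Gam x'.
Proof.
move=> Px Px' sub; apply/fintype.subsetP => B /(GammaP _ _ blocks_k)[m [mI mE mB]].
apply/(GammaP _ _ blocks_k); exists m; split=> // j.
apply: fintype.subsetP (mE j); apply: finset.setUS; apply/bigcupsP => l jl.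
by apply: finset.bigcup_sup; apply: sub.
Qed.

Lemma tclassP x x' : tclass x x' <-> constant (x' - x).
Proof.
split=> [[a _ <-] i j|h]; first by rewrite !ffunE !addrK.
have i := Ordinal k0; exists ((x' - x) i) => //.
apply/ffunP => j; rewrite ffunE (h i j) !ffunE; exact: subrK.
Qed.

(** The constraints that are tight at [x] define the smallest face of [P]
    containing [x]; their sum is a functional exposing it. *)
Lemma full_Vert x : P x -> full pc U z (dup x) -> Vert P x.
Proof.
move=> Px fx; right.
pose d (x' : vec R 'I_k) : R := \sum_i \sum_(c | vertex_graph v x i c) (x' c - x' i).
pose c : vec R 'I_k := [ffun j => \sum_i \sum_(c | vertex_graph v x i c)
  ((c == j)%:R - (i == j)%:R)].
have dE x' : dotp c x' = d x'.
  rewrite /dotp /d; under eq_bigr => j _ do rewrite ffunE mulr_suml.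
  rewrite exchange_big; apply: eq_bigr => i _ /=.
  under eq_bigr => j _ do rewrite mulr_suml.
  rewrite exchange_big; apply: eq_bigr => l _ /=.
  under eq_bigr => j _ do rewrite mulrBl.
  rewrite sumrB; congr (_ - _).
    by rewrite (bigD1 l) //= eqxx mul1r big1 ?addr0 // => j /negPf jl;
      rewrite eq_sym jl mul0r.
  by rewrite (bigD1 i) //= eqxx mul1r big1 ?addr0 // => j /negPf jl;
    rewrite eq_sym jl mul0r.
have xE i l : vertex_graph v x i l -> (x l : R) - x i = v i l - v i i.
  by move=> /(vertex_graphP _ _ Px)[].
exists c; apply/seteqP; split=> [_ [a _ <-]|x' [Px' x'max]].
  split; first exact: P_tscale.
  move=> x' Px'; rewrite !dE; apply: ler_sum => i _; apply: ler_sum => l /xE E.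
  by rewrite !ffunE; have /sectorP /(_ i l) := Px'; lra.
apply/tclassP; have := x'max x Px; rewrite !dE => le.
have termle i l : vertex_graph v x i l -> (x' l : R) - x' i <= x l - x i.
  by move=> /xE ->; have /sectorP := Px'.
have sub i l : vertex_graph v x i l -> vertex_graph v x' i l.
  move=> il; apply/(vertex_graphP _ _ Px'); rewrite -xE //.
  split; first by case/andP: il.
  apply/eqP; rewrite eq_le termle //=; move: le; rewrite /d.
  rewrite (bigD1 i) //= [leRHS](bigD1 i) //= (bigD1 l) //= [X in _ <= X + _](bigD1 l) //=.
  set a := \sum_(_ | _ && _) _; set b := \sum_(_ < k | _) _.
  set a' := \sum_(_ | _ && _) _; set b' := \sum_(_ < k | _) _.
  have : a' <= a by apply: ler_sum => l' /andP[/termle].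
  have : b' <= b by apply: ler_sum => i' _; apply: ler_sum => l' /termle.
  by lra.
have FF : F (dup x) \subset F (dup x').
  by rewrite (F_dup Px) (F_dup Px'); apply: vertex_graph_sub.
have := fx _ (minfam_orth (subxx _) FF).
move=> h i j; have [s <-] := block_repr i; have [t <-] := block_repr j.
by have := h s t; rewrite !ffunE.
Qed.

(** A direction orthogonal to the initial bases keeps the tight constraints
    tight, so [x] can be moved along it both ways inside [P], which is impossible
    at a vertex unless the direction is constant. *)
Lemma Vert_full x : Vert P x -> full pc U z (dup x).
Proof.
move=> Vx; have Px := Vert_sub Vx; case: Vx => [E|[c E]].
  have : tclass x x by apply/tclassP => i j; rewrite !ffunE !subrr.
  by rewrite E.
move=> e; rewrite (F_dup Px) => /(orth_Gamma Px)[e' -> e'x].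
have [ep ep0 hp] : exists2 a, 0 < a & forall d : R, 0 < d <= a ->
    P (x + d *: e') /\ P (x - d *: e').
  pose f (ij : 'I_k * 'I_k) : R := if vertex_graph v x ij.1 ij.2 || (ij.1 == ij.2)
    then -1 else (x ij.2 - x ij.1) - (v ij.1 ij.2 - v ij.1 ij.1).
  pose g (ij : 'I_k * 'I_k) : R := `|(e' ij.2 : R) - e' ij.1|.
  have f0 ij : f ij < 0.
    rewrite /f; case: ifPn => [_|]; first lra.
    rewrite negb_or => /andP[N ne]; rewrite subr_lt0 lt_def.
    have /sectorP -> := Px; rewrite andbT.
    apply: contra N => /eqP N; apply/(vertex_graphP _ _ Px).
    by split; [rewrite eq_sym | rewrite N].
  have [a a0 ha] := small_eps g f0; exists a => // d da.
  have main (s : R) : `|s| <= d -> P (x + s *: e').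
    have xE i : ((x + s *: e') i : R) = x i + s * (e' i : R) by rewrite !ffunE.
    move=> sd; apply/sectorP => i j; rewrite !xE.
    have := ha d da (i, j); rewrite /f /=; have /sectorP /(_ i j) := Px => Pij.
    have [/orP[ij|/eqP ->] _|_ h] := ifPn; [|lra|].
      by rewrite (e'x _ _ ij); lra.
    have : s * (e' j : R) - s * (e' i : R) <= d * g (i, j).
      by rewrite -mulrBr (le_trans (ler_norm _)) // normrM ler_wpM2r.
    by move=> hs; lra.
  have /andP[d0 _] := da.
  by split; [apply: main | rewrite -scaleNr; apply: main; rewrite normrN];
    rewrite gtr0_norm.
have [] := hp ep; first by rewrite ep0 lexx.
move=> P1 P2; have : tclass x x by apply/tclassP => i j; rewrite !ffunE !subrr.
rewrite E => -[_ xmax].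
have := xmax _ P1; have := xmax _ P2; rewrite dotpBr dotpDr dotpZr => h1 h2.
have ce : ep * dotp c e' = 0 by lra.
have : tclass x (x + ep *: e').
  rewrite E; split=> // x' Px'; rewrite dotpDr dotpZr ce addr0; exact: xmax.
move=> /tclassP; rewrite addrC addKr => he s t; rewrite !ffunE.
have := he (blk s) (blk t); rewrite !ffunE.
by move/(mulfI (lt0r_neq0 ep0)).
Qed.

(** At a full point there is neither a loop nor a coloop [s], since otherwise the
    unit vector of [s] would be orthogonal to the minimal family. *)
Lemma full_dup y : full pc U z y -> exists2 w, Vert P w & y = dup w.
Proof.
move=> fy.
have notcst (s : S) : ~ constant [ffun r => (r == s)%:R : R^o].
  move=> h; have [t ts] := two_elts s; have := h s t.
  by rewrite !ffunE eqxx (negPf ts) => /eqP; rewrite oner_eq0.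
have sumd (s : S) B : \sum_(r in B) ([ffun r => (r == s)%:R] : vec R S) r = (s \in B)%:R.
  rewrite big_mkcond (bigD1 s) //= ffunE eqxx big1 => [|r /negPf rs].
    by rewrite addr0; case: (s \in B).
  by rewrite ffunE rs; case: ifP.
have [||w Pw yw] := @loopless_dup y.
- move=> s; rewrite min_basesE; apply: contrapT => N; apply: (notcst s); apply: fy.
  have {}N B : B \in F y -> (s \in B) = false.
    by move=> BF; apply/negP => sB; apply: N; exists B.
  by move=> B B' BF B'F; rewrite !dotp_co_indicator !sumd !N.
- move=> s; rewrite min_basesE; apply: contrapT => N; apply: (notcst s); apply: fy.
  have {}N B : B \in F y -> (s \in B) = true.
    by move=> BF; apply: contrapT => /negP sB; apply: N; exists B.
  by move=> B B' BF B'F; rewrite !dotp_co_indicator !sumd !N.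
- by exists w => //; apply: full_Vert => //; rewrite -yw.
Qed.

(** * The subdivision and its dual complex *)

Lemma uniform_elt : exists B, B \in U.
Proof.
have [s _] := an_elt; have [t ts] := two_elts s.
have [m [mI _ _ _]] := transversal ts.
by exists (im m); rewrite mem_uniform card_im // card_ord.
Qed.

Lemma S_gt1 : (1 < #|S|)%N.
Proof.
have [s _] := an_elt; have [t ts] := two_elts s.
by apply/card_gt1P; exists t, s.
Qed.

Lemma sum_co_indicator B : B \in U -> \sum_s co_indicator B s = (#|S| - k)%N%:R :> R.
Proof.
rewrite mem_uniform => /eqP Bk; under eq_bigr => s _ do rewrite co_indicatorE.
rewrite -natr_sum; congr (_%:R); rewrite -Bk -[X in _ = (X - _)%N](cardsC B) addKn.
rewrite -sum1_card [RHS]big_mkcond; apply: eq_bigr => s _.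
by rewrite finset.in_setC; case: (s \in B).
Qed.

Lemma kappa_neq0 : (#|S| - k)%N%:R != 0 :> R.
Proof. by rewrite pnatr_eq0 -lt0n subn_gt0 ltk. Qed.

Lemma dual_uniform : dual_matroid U = uniform (#|S| - k) [set: S]%SET.
Proof.
apply/finset.setP => B; rewrite mem_uniform; apply/imsetP/eqP => [[C]|Bk].
  by rewrite mem_uniform => /eqP Ck ->; rewrite cardsCs finset.setCK Ck.
exists (~: B)%SET; last by rewrite finset.setCK.
by rewrite mem_uniform cardsCs finset.setCK Bk subKn // ltnW // ltk.
Qed.

Lemma hypersimplexE :
  hypersimplex (#|S| - k) = [set u : vec R S | cvx_comb pc U u].
Proof. by rewrite /hypersimplex -dual_uniform base_polytope_dual. Qed.

Definition vertex_subdivision : set (set (vec R S)) :=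
  [set base_polytope (dual_matroid (Gam w)) | w in Vert P].

Lemma vertex_subdivisionE : vertex_subdivision = [set cell y | y in full pc U z].
Proof.
apply/seteqP; split=> [_ [w wV <-]|_ [y fy <-]].
  exists (dup w); first exact: Vert_full.
  by rewrite (F_dup (Vert_sub wV)) base_polytope_dual.
have [w wV ->] := full_dup fy; exists w => //.
by rewrite (F_dup (Vert_sub wV)) base_polytope_dual.
Qed.

(** When both bases are minimal, so are both results of an exchange. *)
Lemma min_bases_matroid y : is_matroid (dual_matroid (min_bases U z y)).
Proof.
have [B BU] := uniform_elt; split.
  have [C CF] := minfam_neq0 pc z BU y; apply/set0Pn; exists (~: C)%SET.
  by apply: imset_f; rewrite min_basesE.
move=> _ _ /imsetP[B1 B1m ->] /imsetP[B2 B2m ->] s.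
rewrite finset.in_setD !finset.in_setC negbK => /andP[s2 s1].
have /min_basesP[k1 min1] := B1m; have /min_basesP[k2 min2] := B2m.
have [|t] := zval k2 k1 (s := s); first by rewrite finset.in_setD s1 s2.
rewrite finset.in_setD => /andP[t2 t1] le.
exists t; first by rewrite finset.in_setD !finset.in_setC negbK t1 t2.
have -> : (t |: (~: B1 :\ s) = ~: (s |: (B1 :\ t)))%SET.
  apply/finset.setP => r; rewrite !finset.inE negb_or negb_and negbK.
  have [->|rt] /= := eqVneq r t; last by [].
  by rewrite andbT; apply/esym; apply: contraNneq t2 => ->.
apply: imset_f; apply/min_basesP; split=> [|B' B'k].
  by rewrite card_exchange.
have h1 := min1 B' B'k; have h2 := min2 (t |: (B2 :\ s))%SET.
rewrite card_exchange // sum_exchange // in h2; have {}h2 := h2 k2.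
by rewrite sum_exchange //; lra.
Qed.

Lemma cell_matroid y : exists2 M, is_matroid M & cell y = base_polytope M.
Proof.
exists (dual_matroid (min_bases U z y)); first exact: min_bases_matroid.
by rewrite base_polytope_dual min_basesE.
Qed.

Lemma vertex_subdivision_matroid : matroid_subdivision (#|S| - k) vertex_subdivision.
Proof.
have [B BU] := uniform_elt.
have fdim y : full pc U z y -> affdim (cell y) (#|S| - 1).
  by move=> fy; apply: (full_affdim BU sum_co_indicator (ltnW S_gt1) fy).
rewrite vertex_subdivisionE; split.
- apply: (@sub_finite_set _ _
    [set [set u : vec R S | cvx_comb pc M u] | M in [set: {set {set S}}]]).
    by move=> _ [y _ <-]; exists (F y).
  by apply: finite_image; apply: finite_finset.
- by move=> _ [y _ <-]; apply: cell_matroid.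
- by exists (#|S| - 1)%N => _ [y fy <-]; apply: fdim.
- move=> _ _ [y _ <-] [y' _ <-]; split; first exact: cap_face BU y y'.
  by rewrite setIC; exact: cap_face BU y' y.
- split.
    move=> _ _ [y fy <-] [y' fy' <-].
    have [n [q [q0 fq eq qn]]] := full_connected BU kappa_neq0 sum_co_indicator fy fy'.
    exists n, (fun i => cell (q i)); split.
    + by rewrite q0.
    + by rewrite qn.
    + by move=> i _; exists (q i).
    + move=> i lt; exists (#|S| - 2)%N; split.
        by rewrite -subSn ?S_gt1 // subSS; apply: fdim.
      exact: (edge_affdim BU sum_co_indicator (ltnW S_gt1) (eq i lt)).
  rewrite hypersimplexE; apply/seteqP; split=> [u [_ [y _ <-]]|u /= uU].
    by apply: cvx_combS; apply: minfam_sub.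
  have [y fy uy] := covering z BU kappa_neq0 sum_co_indicator uniform_gen uU.
  by exists (cell y) => //; exists y.
Qed.

Lemma vertex_subdivision_regular : regular_subdivision (#|S| - k) vertex_subdivision.
Proof.
have [B BU] := uniform_elt.
have [f [fconv fP]] := regular_height z BU kappa_neq0 sum_co_indicator uniform_gen.
exists f; rewrite hypersimplexE; split.
  move=> t u u' /set_mem uU /set_mem u'U; apply: fconv => //.
  by rewrite ge0 le1.
rewrite vertex_subdivisionE => _ [y _ <-]; exists (- y), (mu pc U z B y) => u /(fP y).
by rewrite /aff dotpNl addrC.
Qed.

Lemma tls_cellE y : tls_cell U z y = [set y' | F y \subset F y'].
Proof. by apply/seteqP; split=> y'; rewrite /tls_cell /= !min_basesE. Qed.

Lemma tls_cell_sub y y' : tls_cell U z y `<=` tls_cell U z y' <-> F y' \subset F y.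
Proof.
rewrite !tls_cellE; split=> [|sub r /= yr]; first by apply => /=.
exact: fintype.subset_trans sub yr.
Qed.

Lemma tls_cell_eq y y' : tls_cell U z y = tls_cell U z y' <-> F y = F y'.
Proof.
split=> [E|E]; last by rewrite !tls_cellE E.
apply/eqP; rewrite finset.eqEsubset.
by apply/andP; split; apply/tls_cell_sub; rewrite E.
Qed.

Lemma cell_sub_hyperplane y s :
  (cell y `<=` [set u : vec R S | u s = 1]) <-> forall B, B \in F y -> s \notin B.
Proof.
split=> [h B BF|h u [l [l0 lF l1 ->]] /=].
  have /h /= : cell y (pc B) by apply: cvx_comb1.
  by rewrite co_indicatorE; case: (s \in B) => // /eqP; rewrite eq_sym oner_eq0.
rewrite sum_ffunE -[RHS]l1; apply: eq_bigr => B _; rewrite ffunE.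
have [/h sB|/lF ->] := boolP (B \in F y); last exact: mul0r.
by rewrite co_indicatorE sB; exact: mulr1.
Qed.

Lemma tls_loopless y : trop_linear_space U z y <->
  forall s, ~ (cell y `<=` [set u : vec R S | u s = 1]).
Proof.
rewrite (trop_linear_spaceP y ltk zval); split=> h s.
  move=> /cell_sub_hyperplane N; have [B] := h s.
  by rewrite min_basesE => /N /negPf ->.
apply: contrapT => N; apply: (h s); apply/cell_sub_hyperplane => B BF.
by apply/negP => sB; apply: N; exists B; rewrite ?min_basesE.
Qed.

(** A cell of the linear space is sent to the polytope of the dual of its
    initial matroid.  The directions of the cell are those orthogonal to the
    differences of the initial bases, so the dimensions are complementary. *)
Lemma vertex_subdivision_dual : tls_dual U z vertex_subdivision.
Proof.
have [B BU] := uniform_elt.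
have /choice[g gP] : forall C, exists y, tls_cells U z C ->
    trop_linear_space U z y /\ C = tls_cell U z y.
  move=> C; have [[y yL yC]|N] := pselect (tls_cells U z C); first by exists y.
  by exists 0.
have cell_eq y y' : cell y = cell y' -> F y = F y'.
  move=> E; apply/eqP; rewrite finset.eqEsubset.
  by apply/andP; split; apply: (@cvx_co_indicator_sub R); rewrite E.
exists (fun C => cell (g C)); split.
- split.
  + move=> C /gP[gL _]; split; last exact/tls_loopless.
      have [b bF] := minfam_neq0 pc z BU (g C).
      have bU : b \in U by apply: (fintype.subsetP (minfam_sub pc U z (g C))).
      have [y [fy sub _]] := extend_full z BU uniform_gen (g C)
        (cvx_comb1 pc bU).
      rewrite vertex_subdivisionE; exists (cell y); first by exists y.
      have := cap_face pc z BU y (g C); rewrite (cell_cap_min pc z BU) (finset.setIidPr sub).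
      by [].
    have [b bF] := minfam_neq0 pc z BU (g C).
    by exists (pc b); apply: cvx_comb1.
  + move=> C D /set_mem CL /set_mem DL /cell_eq E.
    have [_ ->] := gP C CL; have [_ ->] := gP D DL.
    by apply/tls_cell_eq.
  + move=> X [[Q]]; rewrite vertex_subdivisionE => -[y fy <-] XQ XN Xs.
    have [d Xd] := cell_face BU XQ XN; subst X.
    have xL : trop_linear_space U z (y - d) by apply/tls_loopless.
    have CL : tls_cells U z (tls_cell U z (y - d)) by exists (y - d).
    exists (tls_cell U z (y - d)) => //.
    by have [_ /esym/tls_cell_eq ->] := gP _ CL.
- move=> C D CL DL; have [_ CE] := gP C CL; have [_ DE] := gP D DL.
  rewrite [in X in X <-> _]CE [in X in X <-> _]DE tls_cell_sub; split=> [sub|].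
    by move=> u; apply: cvx_combS.
  exact: cvx_co_indicator_sub.
- move=> C d CL dC; have [_ CE] := gP C CL.
  have [V [memV _ dimV]] := orth_dim pc (minfam_neq0 pc z BU (g C)).
  have := dual_cell_dim BU memV; rewrite -tls_cellE -CE.
  by move=> /(affdim_uniq dC) E; rewrite -subnDA add1n E.
Qed.

Lemma uniform_matroid : is_matroid U.
Proof.
split; first by have [B BU] := uniform_elt; apply/set0Pn; exists B.
move=> B1 B2; rewrite !mem_uniform => /eqP k1 /eqP k2 s s12.
have [t t21 _] := zval k1 k2 s12; exists t => //; rewrite mem_uniform.
move: s12 t21; rewrite !finset.in_setD => /andP[_ s1] /andP[t1 _].
by rewrite card_exchange // k1.
Qed.

(** If the ranks added up, all the bases would have the same number of elements
    in [A]. *)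
Lemma uniform_connected : connected_matroid U.
Proof.
move=> A /set0Pn[s sA]; rewrite -finset.subTset => /fintype.subsetPn[t _ tA].
rewrite (rk_uniform (ltnW ltk)); apply/eqP => rkE.
have rankle C B : B \in U -> (#|C :&: B|%SET <= rank U C)%N.
  by move=> BU; apply: (leq_bigmax_cond (F := fun B => #|C :&: B|%SET)).
have eqA B : B \in U -> #|A :&: B|%SET = rank U A.
  move=> BU; apply/eqP; rewrite eqn_leq rankle //=.
  have /eqP Bk : #|B| == k by rewrite -mem_uniform.
  have := rankle (~: A)%SET B BU.
  rewrite -(leq_add2l (rank U A)) rkE -Bk -[leqRHS](cardsID A B) finset.setDE.
  by rewrite ![(B :&: _)%SET]finset.setIC leq_add2r.
have st : s != t by apply: contraNneq tA => <-.
have [m [mI _ sm tm]] := transversal st.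
have mk : #|im m| = k by rewrite card_im // card_ord.
have mU : im m \in U by rewrite mem_uniform mk.
have := eqA _ mU; have := eqA (t |: (im m :\ s))%SET.
rewrite mem_uniform card_exchange // mk eqxx => /(_ isT) <-.
rewrite (cardsD1 s) finset.in_setI sA sm => /eqP.
suff -> : (A :&: (t |: (im m :\ s)) = (A :&: im m) :\ s)%SET.
  by rewrite add1n -[X in _ == X]add0n -add1n eqn_add2r.
apply/finset.setP => r; rewrite !finset.inE.
by have [->|_] := eqVneq r t; [rewrite (negPf tA) /= andbF | rewrite andbCA].
Qed.

(** The constraints that are tight at the midpoint of two points of [P] are those
    tight at both.  So at a point with the fewest tight constraints, these are
    tight on all of [P], and its cell contains [dup P]. *)
Lemma cell_generic : exists2 x, P x & tls_cell U z (dup x) = dup @` P.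
Proof.
pose arrows x := [set ij : 'I_k * 'I_k | vertex_graph v x ij.1 ij.2]%SET.
have exn : exists n, `[< exists2 x, P x & #|arrows x| = n >].
  by exists #|arrows (v (Ordinal k0))|; apply/asboolP; exists (v (Ordinal k0)).
case: (ex_minnP exn) => n /asboolP[x Px <-] xmin; exists x => //.
apply/seteqP; split=> [y /(cell_dup Px)[x' Px' ->]|_ [x' Px' <-]]; first by exists x'.
rewrite /tls_cell /= (min_bases_dup Px) (min_bases_dup Px').
apply: vertex_graph_sub => // i c ic.
pose x1 : vec R 'I_k := 2^-1 *: (x + x').
have x1E j : (x1 j : R) = 2^-1 * ((x j : R) + x' j) by rewrite !ffunE.
have Px1 : P x1.
  apply/sectorP => a b; rewrite !x1E.
  by have /sectorP /(_ a b) := Px; have /sectorP /(_ a b) := Px'; lra.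
have arr1 a b : vertex_graph v x1 a b -> vertex_graph v x a b /\ vertex_graph v x' a b.
  move=> /(vertex_graphP _ _ Px1)[ba]; rewrite !x1E => E.
  have /sectorP /(_ a b) h := Px; have /sectorP /(_ a b) h' := Px'.
  by split; apply/vertex_graphP => //; split=> //; lra.
have /eqP arrE : arrows x1 == arrows x.
  rewrite eqEcard xmin; last by apply/asboolP; exists x1.
  rewrite andbT; apply/fintype.subsetP => -[a b].
  by rewrite !finset.in_set => /arr1[].
have : (i, c) \in arrows x1 by rewrite arrE finset.in_set.
by rewrite finset.in_set => /arr1[].
Qed.

End SectorPolytope.

(** * Biconvex polytopes are cut out by sectors *)

Lemma tcombE {R : realType} {I : finType} n (a : 'I_n.+1 -> R)
    (x : 'I_n.+1 -> vec R I) j :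
  (tcomb a x j : R) =
  \big[Num.min / a ord0 + x ord0 j]_(i < n.+1) (a i + x i j).
Proof.
rewrite /tcomb (big_morph (fun f : vec R I => f j : R)
  (id1 := a ord0 + x ord0 j) (op1 := Num.min)).
- by apply: eq_bigr => i _; rewrite ffunE.
- by move=> f g; rewrite ffunE.
- by rewrite ffunE.
Qed.

Section Biconvex.
Context {R : realType} {k : nat}.
Implicit Types (P V : set (vec R 'I_k)) (x : vec R 'I_k).

Lemma tconv_tconvex V : tconvex (tconv V).
Proof. by move=> n a x h A AV; apply: (proj1 AV) => i; apply: h. Qed.

(** The minimum of two points inherits its generator from the one with the
    smaller [i]-th coordinate. *)
Lemma tconv_dominated V x i : tconv V x ->
  exists2 u, V u & forall j, (x j : R) - x i <= u j - u i.
Proof.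
move: x; apply: smallest_sub => [|u Vu]; last by exists u.
apply: closed_tconvex => [a x [u Vu h]|x x' [u Vu h] [u' Vu' h']].
  by exists u => // j; rewrite !ffunE; have := h j; lra.
have [le|lt] := leP (x i : R) (x' i).
  exists u => // j; rewrite !ffunE; have := h j.
  have : Num.min (x j : R) (x' j) <= x j by rewrite ge_min lexx.
  by rewrite [Num.min (x i : R) _]min_l //; lra.
exists u' => // j; rewrite !ffunE; have := h' j.
have : Num.min (x j : R) (x' j) <= x' j by rewrite ge_min lexx orbT.
by rewrite [Num.min (x i : R) _]min_r ?(ltW lt) //; lra.
Qed.

(** A finite family that dominates a convex set has an element that dominates
    all of it: on a segment from an element [p] with maximal coordinate sum
    towards a point not dominated by [p], the points close to [p] are dominated
    by no element. *)
Lemma dominating_generator P V i : finite_set V -> V !=set0 -> V `<=` P ->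
  (forall x x' (t : R), 0 <= t <= 1 -> P x -> P x' -> P (t *: x + (1 - t) *: x')) ->
  (forall x, P x -> exists2 u, V u & forall j, (x j : R) - x i <= u j - u i) ->
  exists2 p, V p & forall x, P x -> forall j, (x j : R) - x i <= p j - p i.
Proof.
move=> /finite_seqP[s Vs] [u0 Vu0] VP Pc dom.
pose w (a : 'I_(size s)) : vec R 'I_k := tnth (in_tuple s) a.
have Vw a : V (w a) by rewrite Vs /=; apply: mem_tnth.
have wV u : V u -> exists a, u = w a.
  by rewrite Vs /= => us; have /tnthP[a ->] : u \in in_tuple s by []; exists a.
have [a0 _] := wV u0 Vu0; clear Vs.
pose h (u : vec R 'I_k) : R := \sum_j ((u j : R) - u i).
case: (@arg_maxP _ R _ a0 xpredT (fun a => h (w a)) isT) => a _ amax.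
exists (w a) => // q Pq j; rewrite leNgt; apply/negP => lt.
pose p : vec R 'I_k := w a; rewrite -/p in lt.
(* Only the coordinates where the generator fails to dominate [p] matter. *)
pose f (bl : 'I_(size s) * 'I_k) : R :=
  if (w bl.1 bl.2 : R) - w bl.1 i < p bl.2 - p i
  then ((w bl.1 bl.2 : R) - w bl.1 i) - (p bl.2 - p i) else -1.
pose g (bl : 'I_(size s) * 'I_k) : R := ((p bl.2 : R) - p i) - (q bl.2 - q i).
have f0 bl : f bl < 0 by rewrite /f; case: ifP => [|_]; [rewrite subr_lt0 | lra].
have [e e0 he] := small_eps g f0.
pose d := Num.min e 1.
have d0 : 0 < d by rewrite lt_min e0 ltr01.
have de : d <= e by rewrite ge_min lexx.
have d1 : d <= 1 by rewrite ge_min lexx orbT.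
pose r := d *: q + (1 - d) *: p.
have rE l : (r l : R) = d * (q l : R) + (1 - d) * (p l : R) by rewrite !ffunE.
have Pr : P r by apply: Pc => //; [rewrite d1 ltW | apply: VP; apply: Vw].
have [u Vu ru] := dom r Pr; have [b ub] := wV u Vu; subst u.
have pw l : (p l : R) - p i <= w b l - w b i.
  rewrite leNgt; apply/negP => lt'.
  have := he d; rewrite d0 de => /(_ isT (b, l)); rewrite /f /g /= lt'.
  by have := ru l; rewrite !rE => h1 h2; lra.
have eqh l : (w b l : R) - w b i = p l - p i.
  have : h (w b) - h p <= 0 by rewrite subr_le0; apply: amax.
  rewrite /h -sumrB => le0.
  have ge0 (m : 'I_k) : true -> 0 <= ((w b m : R) - w b i) - (p m - p i).
    by move=> _; rewrite subr_ge0.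
  have /eqP : \sum_m (((w b m : R) - w b i) - (p m - p i)) = 0.
    by apply/eqP; rewrite eq_le le0 sumr_ge0.
  rewrite psumr_eq0 // => /allP /(_ l (mem_index_enum l)) /=.
  by rewrite subr_eq0 => /eqP.
have := ru j; rewrite eqh !rE => h1.
have : 0 < d * (((q j : R) - q i) - (p j - p i)) by rewrite mulr_gt0 // subr_gt0.
lra.
Qed.

(** The apices are the dominating generators; a point of all the sectors is a
    tropical combination of them. *)
Lemma biconvex_sectors P : (0 < k)%N -> biconvex P ->
  exists2 v : 'I_k -> vec R 'I_k, forall i, P (v i) &
    P = \bigcap_(i in [set: 'I_k]) sector (v i) i.
Proof.
move=> k0 [[W [_ _ PW]] [V [Vfin V0 PV]]].
have Pt : tconvex P by rewrite PV; apply: tconv_tconvex.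
have Pc x x' (t : R) : 0 <= t <= 1 -> P x -> P x' -> P (t *: x + (1 - t) *: x').
  rewrite PW => t01 [a _ [y yW <-]] [a' _ [y' y'W <-]].
  exists (t * a + (1 - t) * a') => //; exists (t *: y + (1 - t) *: y').
    by have /convex_setP cW := @conv_hull_convex R _ W; apply: cW.
  apply/ffunP => j; rewrite !ffunE.
  have scE (b c : R) : b *: (c : R^o) = b * c by [].
  by rewrite !scE; ring.
have VP : V `<=` P by rewrite PV; apply: sub_gen_smallest.
have dom i x : P x -> exists2 u, V u & forall j, (x j : R) - x i <= u j - u i.
  by rewrite PV; apply: tconv_dominated.
have /choice[v vP] : forall i, exists p,
    P p /\ forall x, P x -> forall j, (x j : R) - x i <= p j - p i.
  move=> i; have [p Vp pmax] := dominating_generator Vfin V0 VP Pc (dom i).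
  by exists p; split=> //; apply: VP.
exists v => [i|]; first exact: (proj1 (vP i)).
apply/seteqP; split=> [x Px i _ j _ /=|x xs].
  by have := proj2 (vP i) x Px j; lra.
have xv i j : (x j : R) <= x i - v i i + v i j.
  have [->|ji] := eqVneq j i; first lra.
  by have /= := xs i I j ji; lra.
case: k k0 P V W PW Vfin V0 PV Pt Pc VP dom v vP x xs xv => // n _.
move=> P V W _ _ _ _ Pt _ _ _ v vP x _ xv.
suff -> : x = tcomb (fun i => (x i : R) - v i i) v.
  by apply: Pt => i; apply: (proj1 (vP i)).
apply/ffunP => j; apply/eqP; rewrite eq_le; apply/andP; split.
  rewrite tcombE; elim/big_ind: _ => // a b xa xb.
  by rewrite le_min xa.
by rewrite tcombE; apply: (@bigmin_inf _ _ _ _ j) => //; lra.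
Qed.

End Biconvex.

(** * Realization of biconvex polytopes by tropical linear spaces *)

Theorem mainTheorem2 (R : realType) :
  (forall (k : nat) (P : set (vec R 'I_k)),
     (1 <= k)%N -> biconvex P ->
     exists (S : finType) (M : {set {set S}}) (z : {set S} -> R)
            (C : set (vec R S)),
       [/\ is_matroid M, connected_matroid M, Dressian M z,
           tls_cells M z C & trop_iso P C])
  /\
  (forall (k : nat) (P : set (vec R 'I_k)) (v : 'I_k -> vec R 'I_k)
          (S : finType) (Sb : 'I_k -> {set S}),
     (1 <= k)%N ->
     maximal_biconvex P ->
     min_generators v P ->
     P = \bigcap_(i in [set: 'I_k]) sector (v i) i ->
     (\bigcup_i Sb i)%SET = [set: S]%SET ->
     (forall i j, i != j -> (Sb i :&: Sb j)%SET = finset.set0) ->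
     (forall i, (maxn 2 k <= #|Sb i|)%N) ->
     let Sigma : set (set (vec R S)) :=
       [set base_polytope (dual_matroid (Gamma Sb (vertex_graph v w)))
         | w in Vert P] in
     [/\ matroid_subdivision (#|S| - k)%N Sigma,
         regular_subdivision (#|S| - k)%N Sigma &
         exists z : {set S} -> R,
           [/\ Dressian (uniform k [set: S]%SET) z,
               trop_iso P (bounded_part (uniform k [set: S]%SET) z) &
               tls_dual (uniform k [set: S]%SET) z Sigma]]).
Proof.
split=> [k P k0 /(biconvex_sectors k0)[v Pv PE]|].
  have [S [Sb [blk [blkP big]]]] : exists (S : finType) (Sb : 'I_k -> {set S})
      (blk : S -> 'I_k), (forall s i, (s \in Sb i) = (blk s == i)) /\
      forall i, (maxn 2 k <= #|Sb i|)%N.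
    (* Disjoint blocks of the smallest admissible size. *)
    exists ('I_k * 'I_(maxn 2 k))%type, (fun i => [set s | s.1 == i]%SET), fst.
    split=> [s i|i]; first by rewrite finset.in_set.
    have pairI : injective (fun a : 'I_(maxn 2 k) => (i, a)) by move=> a b [].
    rewrite -[leqLHS]card_ord -(card_imset _ pairI).
    apply/subset_leq_card/fintype.subsetP => _ /imsetP[a _ ->].
    by rewrite finset.in_set.
  have [z zP] := matching_value_exists
    (fun (i : 'I_k) (s : S) => (v i (blk s) : R)).
  have [x Px xE] := cell_generic PE Pv blkP k0 big zP.
  have kS := ltk blkP k0 big; have vz := zval zP.
  exists S, (uniform k [set: S]%SET), z,
    (tls_cell (uniform k [set: S]%SET) z (dup blk x)); split.
  - exact: (uniform_matroid blkP k0 big zP).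
  - exact: (uniform_connected blkP k0 big).
  - exact: (valuated_Dressian (ltnW kS) vz).
  - by exists (dup blk x) => //; exact: (tls_dup PE blkP k0 big zP Px).
  - by rewrite xE; exact: (dup_trop_iso PE blkP k0 big).
move=> k P v S Sb k0 _ [PV _] PE cover disj big Sigma.
have Pv i : P (v i) by rewrite PV; apply: sub_gen_smallest; exists i.
have /choice[blk blkS] : forall s : S, exists i, s \in Sb i.
  move=> s; have : s \in (\bigcup_i Sb i)%SET by rewrite cover finset.in_setT.
  by move=> /finset.bigcupP[i _ si]; exists i.
have blkP s i : (s \in Sb i) = (blk s == i).
  apply/idP/eqP => [si|<-]; last exact: blkS.
  apply/eqP; apply: contraT => /disj E.
  have : s \in (Sb (blk s) :&: Sb i)%SET by rewrite finset.in_setI si blkS.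
  by rewrite E finset.in_set0.
have [z zP] := matching_value_exists (fun (i : 'I_k) s => (v i (blk s) : R)).
have kS := ltk blkP k0 big; have vz := zval zP; split.
- exact: (vertex_subdivision_matroid PE Pv blkP k0 big zP).
- exact: (vertex_subdivision_regular PE Pv blkP k0 big zP).
- exists z; split; first exact: (valuated_Dressian (ltnW kS) vz).
    rewrite (bounded_part_dup PE Pv blkP k0 big zP).
    exact: (dup_trop_iso PE blkP k0 big).
  exact: (vertex_subdivision_dual PE Pv blkP k0 big zP).
Qed.
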